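(* Consider a sequence of lasso problems indexed by $n\to\infty$, with design matrices $X_0=X_0^{(n)}\in\mathbb{R}^{n\times p_n}$ and regularization parameters $\lambda=\lambda_n>0$, where $p_n/n\to\rho$. Suppose that for each $n$ there is a fixed signed model $S_n$ of size $k_n=|S_n|$, with $k_n/n\to\kappa$. Suppose that, for each $n$, the entries of $X_0$ are distributed i.i.d. according to some symmetric distribution on $\mathbb{R}$, and that almost surely the lasso minimizer for $X_0$ is unique for every $y\in\mathbb{R}^n$. If $\kappa>\frac12$, then for any $\rho>\dfrac{\kappa}{\kappa-\frac12}$ we have $$P(A_{S_n}=\emptyset)\to 1\quad\text{as } n\to\infty.$$
   Context: For a matrix $X_0\in\mathbb{R}^{n\times p}$ and $\lambda>0$, the lasso problem with response $y\in\mathbb{R}^n$ is $\min_{\beta_0\in\mathbb{R}^p}\frac12\|y-X_0\beta_0\|_2^2+\lambda\|\beta_0\|_1$. Let $X=(X_0,-X_0)\in\mathbb{R}^{n\times 2p}$. The lasso problem is equivalently written as: minimize $\frac12\|y-X\beta\|_2^2+\lambda\sum_{j=1}^{2p}\beta_j$ over $\beta\in\mathbb{R}^{2p}$ with $\beta\ge 0$ (coordinatewise), where $\beta=(\beta_0^+,\beta_0^-)$ consists of the positive and negative parts of $\beta_0$. When the lasso minimizer is unique for every $y$, this problem has a unique solution $\beta(y)$ for every $y$. Define $\mathrm{supp}(\beta)=\{1\le j\le 2p:\beta_j>0\}$. A signed model is a subset $S\subset\{1,\dots,2p\}$ of size $|S|$, and $A_S=\{y\in\mathbb{R}^n:\mathrm{supp}(\beta(y))=S\}$;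 it depends on the (random) matrix $X_0$. The probability $P$ is with respect to the random matrix $X_0$. A distribution on $\mathbb{R}$ is symmetric if it is invariant under $x\mapsto -x$. *)

(* Defs.v *)
From HB Require Import structures.
From mathcomp Require Import all_boot all_order all_algebra.
From mathcomp Require Import all_classical all_reals all_analysis.

Set Implicit Arguments.
Unset Strict Implicit.
Unset Printing Implicit Defensive.

Import Order.TTheory GRing.Theory Num.Theory.
Import numFieldNormedType.Exports.

Local Open Scope classical_set_scope.
Local Open Scope ring_scope.

Section Lasso.
Variable R : realType.

(* The library norm `|v| on matrices is the sup norm, hence this definition of
   the square of the Euclidean norm. *)
Definition sqnorm2 (n : nat) (v : 'cV[R]_n) : R := \sum_i v i 0 ^+ 2.

Definition norm1 (n : nat) (v : 'cV[R]_n) : R := \sum_i `|v i 0|.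

Definition lasso_objective (n p : nat) (X0 : 'M[R]_(n, p)) (lambda : R)
    (y : 'cV[R]_n) (b0 : 'cV[R]_p) : R :=
  2^-1 * sqnorm2 (y - X0 *m b0) + lambda * norm1 b0.

Definition lasso_minimizer (n p : nat) (X0 : 'M[R]_(n, p)) (lambda : R)
    (y : 'cV[R]_n) (b0 : 'cV[R]_p) : Prop :=
  forall b0' : 'cV[R]_p,
    lasso_objective X0 lambda y b0 <= lasso_objective X0 lambda y b0'.

Definition lasso_unique (n p : nat) (X0 : 'M[R]_(n, p)) (lambda : R) : Prop :=
  forall y : 'cV[R]_n, exists! b0 : 'cV[R]_p, lasso_minimizer X0 lambda y b0.

Definition signed_design (n p : nat) (X0 : 'M[R]_(n, p)) : 'M[R]_(n, p + p) :=
  row_mx X0 (- X0).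

Definition nonneg_vec (m : nat) (b : 'cV[R]_m) : Prop := forall j, 0 <= b j 0.

Definition signed_objective (n p : nat) (X0 : 'M[R]_(n, p)) (lambda : R)
    (y : 'cV[R]_n) (b : 'cV[R]_(p + p)) : R :=
  2^-1 * sqnorm2 (y - signed_design X0 *m b) + lambda * \sum_j b j 0.

Definition signed_solution (n p : nat) (X0 : 'M[R]_(n, p)) (lambda : R)
    (y : 'cV[R]_n) (b : 'cV[R]_(p + p)) : Prop :=
  nonneg_vec b /\
  forall b' : 'cV[R]_(p + p), nonneg_vec b' ->
    signed_objective X0 lambda y b <= signed_objective X0 lambda y b'.

Definition supp (m : nat) (b : 'cV[R]_m) : {set 'I_m} :=
  [set j | 0 < b j 0]%SET.

(* The set A_S = {y | supp (beta y) = S}, with beta y given by the relation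
   "b is a solution at y".  When the solution is unique for every y this is
   literally A_S, see model_regionE.  For exceptional designs, where beta y is
   not defined, no arbitrary choice of a solution enters, so that the event
   "A_S is empty" does not depend on one. *)
Definition model_region (n p : nat) (X0 : 'M[R]_(n, p)) (lambda : R)
    (S : {set 'I_(p + p)}) : set 'cV[R]_n :=
  [set y | exists b : 'cV[R]_(p + p),
             signed_solution X0 lambda y b /\ supp b = S].

Lemma model_regionE (n p : nat) (X0 : 'M[R]_(n, p)) (lambda : R)
    (S : {set 'I_(p + p)}) (beta : 'cV[R]_n -> 'cV[R]_(p + p)) :
  (forall y b, signed_solution X0 lambda y b <-> b = beta y) ->
  model_region X0 lambda S = [set y | supp (beta y) = S].
Proof.
move=> betaP; apply/seteqP; split=> y /=.
  by move=> [b [/betaP -> ?]].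
by move=> sS; exists (beta y); split=> //; apply/betaP.
Qed.

Definition symmetric_law (mu : probability (measurableTypeR R) R) : Prop :=
  forall A : set (measurableTypeR R), measurable A ->
    mu [set x | A (- x)] = mu A.

(* Mutual independence: the product rule over every subfamily J. *)
Definition mutually_independent (d : measure_display) (T : measurableType d)
    (P : probability T R) (I : finType) (Z : I -> {RV P >-> R}) : Prop :=
  forall (J : {set I}) (B : I -> set R), (forall i, measurable (B i)) ->
    P [set w | forall i, i \in J -> B i (Z i w)] =
      (\prod_(i in J) P (Z i @^-1` B i))%E.

Definition iid_entries (d : measure_display) (T : measurableType d)
    (P : probability T R) (n p : nat) (Z : 'I_n -> 'I_p -> {RV P >-> R})
    (mu : probability (measurableTypeR R) R) : Prop :=
  mutually_independent (fun ij : 'I_n * 'I_p => Z ij.1 ij.2) /\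
  forall i j (A : set R), measurable A -> distribution P (Z i j) A = mu A.

Definition random_mx (d : measure_display) (T : measurableType d)
    (P : probability T R) (n p : nat) (Z : 'I_n -> 'I_p -> {RV P >-> R})
    (w : T) : 'M[R]_(n, p) := \matrix_(i, j) Z i j w.

End Lasso.

(* Main.v *)
(* By the first order conditions, [A_S] is nonempty iff some [r] satisfies
   [x_j . r <= 1] for all [2p] signed columns [x_j], with equality on [S]: then [S]
   is a face of the polytope dual to [Q = {r | x_j . r <= 1}].  Uniqueness of the
   lasso says that the columns tight at a point of [Q] are independent, i.e. that
   [Q] is a simple polyhedron.

   McMullen's upper bound argument then bounds the number of faces of size [k]:
   for a generic functional [c], write [c] as a combination of the columns [B]
   tight at a vertex, and let [D] be those with a negative coefficient.  Every face
   lies in exactly one interval [D, B].  As [Q = - Q], vertices come in pairs whose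
   [D] are complementary in [B], so that it is enough, up to a factor 2, to count
   faces with [#|D| <= m := n./2].  Enlarging [D] to size [m] inside the face gives
   at most ['C(p, m) * 2 ^ m * 'C(n - m, k - m)] of them.

   The law of the design is invariant under signed permutations of the columns, so
   all ['C(p, k) * 2 ^ k] signed models of size [k] have the same probability of
   being a face, which is thus at most the ratio of the two numbers, hence at most
   [2 * (3 k (n - m) / (2 (k - m) (p - m))) ^ (k - m)].  When [kappa <= 1], the
   assumption on [rho] keeps the base below a constant [theta < 1]; when
   [1 < kappa], eventually [n < k] and there is no face of size [k]. *)
Require Import Defs.
From HB Require Import structures.
From mathcomp Require Import zify ring lra.
From mathcomp Require Import all_boot all_order all_algebra all_fingroup.
From mathcomp Require Import boolp.

Set Implicit Arguments.
Unset Strict Implicit.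
Unset Printing Implicit Defensive.

Import Order.TTheory GRing.Theory Num.Theory.

Local Open Scope ring_scope.

(** * Faces and vertices of a simple polyhedron *)

Lemma mulmx_col (R : pzSemiRingType) (m n k : nat) (A : 'M[R]_(m, n))
  (B : 'M[R]_(n, k)) (i : 'I_m) (j : 'I_k) (l : 'I_1) :
  (A *m col j B) i l = (A *m B) i j.
Proof. by rewrite !mxE; apply: eq_bigr => h _; rewrite mxE. Qed.

Section Polyhedron.
Variables (R : realFieldType) (q n : nat) (A : 'M[R]_(q, n)).

Definition feasible (r : 'cV[R]_n) : Prop := forall j, (A *m r) j 0 <= 1.

Definition tight (r : 'cV[R]_n) : {set 'I_q} := [set j | (A *m r) j 0 == 1].

Definition supported (a : 'rV[R]_q) (B : {set 'I_q}) : Prop :=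
  forall j, j \notin B -> a 0 j = 0.

Definition in_span (c : 'rV[R]_n) (B : {set 'I_q}) : Prop :=
  exists2 a : 'rV[R]_q, supported a B & c = a *m A.

Definition simple_polyhedron : Prop := forall r, feasible r ->
  forall a : 'rV[R]_q, supported a (tight r) -> a *m A = 0 -> a = 0.

Definition is_face (S : {set 'I_q}) : Prop :=
  exists2 r, feasible r & S \subset tight r.

(** Rows outside [B] are zeroed rather than removed, so that the spans for all [B] are row spaces of
    matrices of one size. *)
Definition mask_rows (B : {set 'I_q}) : 'M[R]_(q, n) :=
  \matrix_(i, j) (if i \in B then A i j else 0).

Lemma mul_mask_rows (a : 'rV[R]_q) (B : {set 'I_q}) :
  a *m mask_rows B = (\row_j (if j \in B then a 0 j else 0)) *m A.
Proof.
apply/rowP=> k; rewrite !mxE; apply: eq_bigr => j _; rewrite !mxE.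
by case: ifP => _; rewrite ?mul0r ?mulr0.
Qed.

Lemma in_spanP (c : 'rV[R]_n) (B : {set 'I_q}) :
  in_span c B <-> (c <= mask_rows B)%MS.
Proof.
split=> [[a aB ->]|/submxP[D ->]].
  apply/submxP; exists a; rewrite mul_mask_rows; congr (_ *m A).
  by apply/rowP=> j; rewrite mxE; case: ifPn => // /aB.
exists (\row_j (if j \in B then D 0 j else 0)); last exact: mul_mask_rows.
by move=> j jB; rewrite mxE (negbTE jB).
Qed.

(** The columns of [cokermx] are annihilated by the rows in [B]; as [c] is outside the row span, one
    of them pairs nontrivially with [c] and can be rescaled. *)
Lemma separation (c : 'rV[R]_n) (B : {set 'I_q}) : ~ in_span c B ->
  exists2 w : 'cV[R]_n, (c *m w) 0 0 = 1 & forall j, j \in B -> (A *m w) j 0 = 0.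
Proof.
move=> /in_spanP/negP; rewrite submxE => /rV0Pn[k ck].
exists (((c *m cokermx (mask_rows B)) 0 k)^-1 *: col k (cokermx (mask_rows B))).
  by rewrite -scalemxAr mxE mulmx_col mulVf.
move=> j jB; rewrite -scalemxAr mxE mulmx_col.
suff -> : (A *m cokermx (mask_rows B)) j k = 0 by rewrite mulr0.
have /matrixP/(_ j k) := mulmx_coker (mask_rows B).
by rewrite [RHS]mxE => <-; rewrite !mxE; apply: eq_bigr => i _; rewrite [mask_rows B _ _]mxE jB.
Qed.

Lemma mulmx_addZ (r w : 'cV[R]_n) (t : R) (j : 'I_q) :
  (A *m (r + t *: w)) j 0 = (A *m r) j 0 + t * (A *m w) j 0.
Proof. by rewrite mulmxDr -scalemxAr !mxE. Qed.

(** Ratio test of the simplex method: [t] is the least step at which a constraint increasing along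
    [w] becomes tight. It is positive because the constraints already tight do not increase. *)
Lemma move_until_tight (r w : 'cV[R]_n) (j0 : 'I_q) :
  feasible r -> 0 < (A *m w) j0 0 ->
  (forall j, j \in tight r -> (A *m w) j 0 <= 0) ->
  exists t, [/\ 0 < t, feasible (r + t *: w) &
    exists2 j, j \notin tight r & j \in tight (r + t *: w)].
Proof.
move=> rQ wj0 wtight.
case: (@arg_minP _ _ _ j0 (fun j => 0 < (A *m w) j 0)
  (fun j => (1 - (A *m r) j 0) / (A *m w) j 0) wj0) => j wj jmin.
have jN : j \notin tight r.
  by apply/negP => /wtight; rewrite leNgt wj.
have r1 : (A *m r) j 0 < 1.
  by rewrite lt_neqAle rQ andbT; move: jN; rewrite inE.
exists ((1 - (A *m r) j 0) / (A *m w) j 0); split.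
- by rewrite divr_gt0 // subr_gt0.
- move=> i; rewrite mulmx_addZ.
  case: (ltP 0 ((A *m w) i 0)) => [wi|wi].
    by have := jmin i wi; rewrite ler_pdivlMr //; lra.
  rewrite (le_trans _ (rQ i)) // gerDl mulr_ge0_le0 //.
  by rewrite divr_ge0 ?ltW // subr_gt0.
- by exists j => //; rewrite inE mulmx_addZ divfK ?lt0r_neq0 // addrC subrK eqxx.
Qed.

(** When [c] is in the span of the tight rows, its value thus depends only on the tight set; this
    makes the pivoting in [optimal_vertex] terminate. *)
Lemma in_span_eval (a : 'rV[R]_q) (B : {set 'I_q}) (r : 'cV[R]_n) :
  supported a B -> B \subset tight r ->
  ((a *m A) *m r) 0 0 = \sum_j a 0 j.
Proof.
move=> aB Br; rewrite -mulmxA mxE; apply: eq_bigr => j _.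
case: (boolP (j \in B)) => [jB|/aB->]; last by rewrite mul0r.
by have := fintype.subsetP Br _ jB; rewrite inE => /eqP ->; rewrite mulr1.
Qed.

Lemma card_tight (r : 'cV[R]_n) :
  simple_polyhedron -> feasible r -> (#|tight r| <= n)%N.
Proof.
move=> sA rQ; set B := tight r.
pose M : 'M_(#|B|, n) := \matrix_(i < #|B|, j < n) A (enum_val i) j.
suff : row_free M by rewrite /row_free => /eqP <-; apply: rank_leq_col.
apply: inj_row_free => v vM.
(* [a] is [v] transported to all row indices, with value 0 outside [B]. *)
pose a : 'rV[R]_q := \row_j \sum_(i | enum_val i == j) v 0 i.
have a0 : a = 0.
  apply: (sA r rQ).
    move=> j jB; rewrite mxE big_pred0 // => i; apply: contraNF jB => /eqP <-.
    exact: enum_valP.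
  rewrite -vM; apply/rowP => k; rewrite !mxE.
  under eq_bigr do rewrite mxE mulr_suml.
  rewrite (exchange_big_dep xpredT) //=; apply: eq_bigr => i _.
  by rewrite (big_pred1 (enum_val i)) ?mxE // => j; rewrite eq_sym.
apply/rowP => i; have /rowP/(_ (enum_val i)) := a0; rewrite !mxE => <-.
by rewrite (big_pred1 i) // => i'; rewrite (inj_eq enum_val_inj).
Qed.

Lemma mulmx_eval_sum (a : 'rV[R]_q) (w : 'cV[R]_n) :
  ((a *m A) *m w) 0 0 = \sum_j a 0 j * (A *m w) j 0.
Proof. by rewrite -mulmxA mxE. Qed.

Variable neg : 'I_q -> 'I_q.
Hypothesis negA : forall j k, A (neg j) k = - A j k.

Lemma mulmx_neg (w : 'cV[R]_n) (j : 'I_q) : (A *m w) (neg j) 0 = - (A *m w) j 0.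
Proof. by rewrite !mxE -sumrN; apply: eq_bigr => k _; rewrite negA mulNr. Qed.

Variables (c : 'rV[R]_n).
Hypothesis c_span : in_span c setT.

(** This stands in for boundedness: a direction increasing [c] leaves the polyhedron, since a row
    that does not vanish along [w] is positive there or has a positive opposite. *)
Lemma ascent_blocked (w : 'cV[R]_n) : 0 < (c *m w) 0 0 ->
  exists j, 0 < (A *m w) j 0.
Proof.
case: c_span => a _ -> cw.
suff [j jw] : exists j, (A *m w) j 0 != 0.
  move: jw; rewrite neq_lt => /orP[jw|jw]; last by exists j.
  by exists (neg j); rewrite mulmx_neg oppr_gt0.
apply/not_existsP => all0; move: cw.
rewrite mulmx_eval_sum big1 ?ltxx // => j _.
by have /negP := all0 j; rewrite negbK => /eqP ->; rewrite mulr0.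
Qed.

(** As long as [c] is not spanned by the tight rows, [separation] gives a direction that increases
    [c] and keeps them tight; moving along it makes one more constraint tight. The induction is on
    the number of constraints not yet tight. *)
Lemma reach_vertex (r : 'cV[R]_n) : feasible r ->
  exists r', [/\ feasible r', tight r \subset tight r', in_span c (tight r') &
    (c *m r) 0 0 <= (c *m r') 0 0].
Proof.
move: {2}(q - #|tight r|)%N (leqnn (q - #|tight r|)) => N.
elim: N r => [|N IH] r rN rQ.
  exists r; split=> //; suff -> : tight r = setT by [].
  apply/eqP; rewrite eqEcard subsetT cardsT card_ord.
  by rewrite -subn_eq0 -leqn0.
have [cr|/separation[w cw wB]] := pselect (in_span c (tight r)).
  by exists r; split.
have [j0 wj0] : exists j, 0 < (A *m w) j 0.
  by apply: ascent_blocked; rewrite cw ltr01.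
have [|t [t0 r'Q [j jN jT]]] := move_until_tight rQ wj0.
  by move=> j /wB ->.
have sub : tight r \subset tight (r + t *: w).
  apply/fintype.subsetP => i ir; rewrite inE mulmx_addZ wB // mulr0 addr0.
  by rewrite inE in ir.
have pr : tight r \proper tight (r + t *: w).
  by apply/properP; split=> //; exists j.
have [|r'' [r''Q sub2 span2 le2]] := IH (r + t *: w) _ r'Q.
  by have := proper_card pr; have := max_card (mem (tight (r + t *: w)));
     rewrite card_ord; lia.
exists r''; split=> //; first exact: subset_trans sub sub2.
apply: le_trans le2; rewrite mulmxDr -scalemxAr [X in _ <= X]mxE lerDl mxE cw mulr1.
exact: ltW.
Qed.

Hypothesis simpleA : simple_polyhedron.

Lemma row_notin_span (r : 'cV[R]_n) (j : 'I_q) : feasible r -> j \in tight r ->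
  ~ in_span (row j A) (tight r :\ j).
Proof.
move=> rQ jr [a aB rowja].
have /rowP/(_ j) : delta_mx 0 j - a = 0.
  apply: (simpleA rQ); last by rewrite mulmxBl -rowja -rowE subrr.
  move=> i ir; rewrite !mxE aB; last by rewrite in_setD1 negb_and ir orbT.
  by rewrite (_ : i == j = false) ?andbF ?subr0 //; apply: contraNF ir => /eqP ->.
rewrite !mxE !eqxx aB; last by rewrite in_setD1 eqxx.
by move/eqP; rewrite subr0 oner_eq0.
Qed.

(** A simplex pivot: by independence some direction loosens constraint [j] alone among the tight
    ones, and [c] grows along it at rate [- a 0 j]. *)
Lemma drop_constraint (r : 'cV[R]_n) (a : 'rV[R]_q) (j : 'I_q) :
  feasible r -> supported a (tight r) -> c = a *m A -> j \in tight r -> a 0 j < 0 ->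
  exists2 r', feasible r' &
    (tight r :\ j \subset tight r') /\ (c *m r) 0 0 < (c *m r') 0 0.
Proof.
move=> rQ ar ca jr aj.
have [w wj wB] := separation (row_notin_span rQ jr).
have {}wj : (A *m (- w)) j 0 = -1.
  by rewrite mulmxN mxE -wj -row_mul [X in _ = - X]mxE.
have {}wB i : i \in tight r :\ j -> (A *m (- w)) i 0 = 0.
  by move=> iB; rewrite mulmxN mxE wB ?oppr0.
have cw : (c *m (- w)) 0 0 = - a 0 j.
  rewrite ca mulmx_eval_sum (bigD1 j) //= wj mulrN1 big1 ?addr0 // => i ij.
  case: (boolP (i \in tight r)) => [ir|/ar ->]; last by rewrite mul0r.
  by rewrite wB ?mulr0 // in_setD1 ij.
have [j0 wj0] : exists j, 0 < (A *m (- w)) j 0.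
  by apply: ascent_blocked; rewrite cw oppr_gt0.
have [|t [t0 r'Q _]] := move_until_tight rQ wj0.
  move=> i ir; case: (eqVneq i j) => [->|ij]; first by rewrite wj lerN10.
  by rewrite wB // in_setD1 ij.
exists (r + t *: - w) => //; split.
  apply/fintype.subsetP => i iB; rewrite inE mulmx_addZ wB // mulr0 addr0.
  by move: iB; rewrite !inE => /andP[].
rewrite mulmxDr -scalemxAr [X in _ < X]mxE ltrDl mxE cw.
by rewrite mulr_gt0 // oppr_gt0.
Qed.

(** Simplex method on the face [S]: drop a constraint outside [S] with negative multiplier, climb
    again to a vertex, and repeat. Constraints in [S] are never dropped. *)
Lemma optimal_vertex (S : {set 'I_q}) : is_face S ->
  exists r a, [/\ feasible r, S \subset tight r, supported a (tight r), c = a *m A &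
    forall j, j \notin S -> 0 <= a 0 j].
Proof.
case=> r0 r0Q Sr0; have [r [rQ /(subset_trans Sr0) Sr cr _]] := reach_vertex r0Q.
(* Termination measure: the possible tight sets of vertices where [c] is larger than at [r]. *)
pose above (r : 'cV[R]_n) := [set B | `[< exists r', [/\ feasible r', tight r' = B,
  in_span c B & (c *m r) 0 0 < (c *m r') 0 0] >]].
move: {2}#|above r| (leqnn #|above r|) => N {r0 r0Q Sr0}.
elim: N r rQ Sr cr => [|N IH] r rQ Sr [a ar ca] rN.
all: have [[j [jS aj]]|allge] := pselect (exists j, j \notin S /\ a 0 j < 0).
all: try by exists r, a; split=> // j jS; rewrite leNgt; apply/negP => aj;
  apply: allge; exists j.
all: have jr : j \in tight r by apply: contraTT aj => /ar ->; rewrite ltxx.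
all: have [r1 r1Q [sub1 lt1]] := drop_constraint rQ ar ca jr aj.
all: have [r2 [r2Q sub2 cr2 le2]] := reach_vertex r1Q.
all: have lt2 := lt_le_trans lt1 le2.
all: have mem : tight r2 \in above r by rewrite inE; apply/asboolP; exists r2.
  by move: rN; rewrite leqn0 cards_eq0 => /eqP r0; rewrite r0 inE in mem.
apply: (IH r2) => //.
  apply: subset_trans sub2; apply: subset_trans sub1.
  apply/fintype.subsetP => i iS; rewrite in_setD1 (fintype.subsetP Sr _ iS) andbT.
  by apply: contraNneq jS => <-.
rewrite -ltnS (leq_trans _ rN) //; apply: proper_card; apply/properP; split.
  apply/fintype.subsetP => B; rewrite !inE => /asboolP[r' [r'Q r'B cB ltr']].
  by apply/asboolP; exists r'; split=> //; apply: lt_trans ltr'.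
(* [tight r2] leaves the measure: a point with the same tight set has the same value of [c]. *)
exists (tight r2) => //; rewrite inE; apply/asboolP => -[r' [r'Q r'B [b b2 cb] ltr']].
move: ltr'; rewrite {1 2}cb (in_span_eval b2) // (in_span_eval b2) ?ltxx //.
by rewrite r'B.
Qed.

(** This describes a vertex [r]; its tight set [B] is a facet of the dual simplicial complex, and
    [D] is the restriction of that facet in the shelling induced by [c]. *)
Definition facet (B D : {set 'I_q}) : Prop := exists r a,
  [/\ feasible r, tight r = B, supported a B, c = a *m A &
    D = [set j | a 0 j < 0]].

Lemma facet_sub (B D : {set 'I_q}) : facet B D -> D \subset B.
Proof.
case=> r [a [_ _ aB _ ->]]; apply/fintype.subsetP => j; rewrite inE.
by apply: contraTT => /aB ->; rewrite ltxx.
Qed.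

Lemma facet_card (B D : {set 'I_q}) : facet B D -> (#|B| <= n)%N.
Proof. by case=> r [a [rQ <- _ _ _]]; apply: card_tight. Qed.

Lemma face_in_facet (S : {set 'I_q}) : is_face S ->
  exists B D, [/\ facet B D, D \subset S & S \subset B].
Proof.
move=> /optimal_vertex[r [a [rQ Sr ar ca aS]]].
exists (tight r), [set j | a 0 j < 0]; split=> //; first by exists r, a.
apply/fintype.subsetP => j; rewrite inE; apply: contraTT => /aS.
by rewrite leNgt.
Qed.

Hypothesis c_generic : forall B, in_span c B -> forall j, in_span (row j A) B.

(** Otherwise [c] would be spanned by the other tight rows, hence by genericity so would row [j],
    against independence. *)
Lemma facet_coef_neq0 (r : 'cV[R]_n) (a : 'rV[R]_q) (j : 'I_q) : feasible r ->
  supported a (tight r) -> c = a *m A -> j \in tight r -> a 0 j != 0.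
Proof.
move=> rQ ar ca jr; apply/eqP => aj; apply: (row_notin_span rQ jr).
apply: c_generic; exists a => // i; rewrite in_setD1 negb_and negbK.
by case/orP => [/eqP ->|/ar].
Qed.

(* A vertex [r] maximizes [c] over the face cut out by any [E] containing the
   indices where the multiplier is negative. *)
Lemma facet_uniq (B D B' D' E : {set 'I_q}) : facet B D -> facet B' D' ->
  D \subset E -> E \subset B -> D' \subset E -> E \subset B' -> B = B' /\ D = D'.
Proof.
have key r a r' a' (F : {set 'I_q}) : feasible r -> feasible r' ->
    supported a (tight r) -> c = a *m A ->
    F \subset tight r -> F \subset tight r' -> [set j | a 0 j < 0] \subset F ->
    supported a' (tight r') -> c = a' *m A -> [set j | a' 0 j < 0] \subset F ->
    tight r \subset tight r'.
  move=> rQ r'Q ar ca Fr Fr' aF ar' ca' aF'.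
  have le r1 a1 r2 : feasible r1 -> feasible r2 -> supported a1 (tight r1) ->
      c = a1 *m A -> F \subset tight r2 -> [set j | a1 0 j < 0] \subset F ->
      (forall j, 0 <= a1 0 j * (1 - (A *m r2) j 0)) /\
      (c *m r1) 0 0 - (c *m r2) 0 0 = \sum_j a1 0 j * (1 - (A *m r2) j 0).
    move=> r1Q r2Q ar1 ca1 Fr2 aF1; split.
      move=> j; case: (ltP (a1 0 j) 0) => aj; last by rewrite mulr_ge0 // subr_ge0.
      have jF : j \in F by apply: (fintype.subsetP aF1); rewrite inE.
      have := fintype.subsetP Fr2 _ jF; rewrite inE => /eqP ->.
      by rewrite subrr mulr0.
    rewrite ca1 (in_span_eval ar1) // mulmx_eval_sum -sumrB.
    by apply: eq_bigr => j _; rewrite mulrBr mulr1.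
  (* Used in both directions, [le] shows that [c] agrees at [r] and [r'], so every term vanishes;
     the coefficients being nonzero on [tight r], these constraints are tight at [r'] too. *)
  have [ge1 eq1] := le _ _ _ rQ r'Q ar ca Fr' aF.
  have [ge2 eq2] := le _ _ _ r'Q rQ ar' ca' Fr aF'.
  have /psumr_eq0P all0 : \sum_j a 0 j * (1 - (A *m r') j 0) = 0.
    apply/eqP; rewrite eq_le sumr_ge0 ?andbT // -eq1.
    by rewrite subr_le0 -subr_ge0 eq2 sumr_ge0.
  apply/fintype.subsetP => j jr; rewrite inE eq_sym -subr_eq0.
  have /eqP := all0 (fun j _ => ge1 j) j isT.
  by rewrite mulf_eq0 (negbTE (facet_coef_neq0 rQ ar ca jr)).
case=> r [a [rQ <- ar ca ->]] [r' [a' [r'Q <- ar' ca' ->]]] aE Er aE' Er'.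
have rr' : tight r = tight r'.
  by apply/eqP; rewrite eqEsubset (key r a r' a' E) // (key r' a' r a E).
split=> //; suff -> : a = a' by [].
apply/eqP; rewrite -subr_eq0; apply/eqP; apply: (simpleA rQ).
  by move=> j jr; rewrite !mxE ar // ar' ?subr0 // -rr'.
by rewrite mulmxBl -ca -ca' subrr.
Qed.

Hypothesis negK : involutive neg.

(** At the vertex [- r] the multipliers change sign. None of them is zero on [B], so the negative
    ones now come exactly from [B :\: D]. *)
Lemma facet_opp (B D : {set 'I_q}) : facet B D -> facet (neg @: B) (neg @: (B :\: D)).
Proof.
have inj := inv_inj negK.
case=> r [a [rQ rB aB ca ->]]; exists (- r), (\row_j - a 0 (neg j)); split.
- by move=> j; rewrite mulmxN mxE -mulmx_neg.
- apply/setP => j; rewrite -[j]negK mem_imset // inE mulmxN mxE mulmx_neg opprK.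
  by rewrite -rB inE.
- move=> j jB; rewrite mxE aB ?oppr0 //; apply: contraNN jB => jB.
  by rewrite -[j]negK mem_imset.
- rewrite ca; apply/rowP => k; rewrite !mxE [LHS](reindex_inj inj) /=.
  by apply: eq_bigr => j _; rewrite mxE negA mulrN mulNr.
- apply/setP => j; rewrite -[j]negK mem_imset // !inE mxE negK oppr_lt0.
  case: (boolP (neg j \in B)) => jB; last by rewrite aB // ltxx andbF.
  have := jB; rewrite -{1}rB => jr; rewrite andbT -leNgt lt_neqAle eq_sym.
  by rewrite (facet_coef_neq0 rQ _ ca jr) // rB.
Qed.

End Polyhedron.

(** * Generic linear functionals *)

Lemma exists_nonroot (R : numDomainType) (p : {poly R}) : p != 0 ->
  exists t, ~~ root p t.
Proof.
move=> p0; apply/not_existsP => allroot.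
have : (size [seq i%:R : R | i <- iota 0 (size p)] < size p)%N.
  apply: max_poly_roots => //.
    by apply/allP => t _; apply/negPn/negP/allroot.
  rewrite map_inj_uniq ?iota_uniq // => i j /eqP; rewrite eqr_nat.
  by move/eqP.
by rewrite size_map size_iota ltnn.
Qed.

Section Generic.
Variables (R : realFieldType) (q n : nat) (A : 'M[R]_(q, n)).

(* A suitable point of the moment curve [t |-> \sum_j t ^ j A_j] avoids the
   finitely many proper subspaces spanned by rows of [A]. *)
Lemma exists_generic : exists2 c : 'rV[R]_n, in_span A c setT &
  forall B, in_span A c B -> forall j, in_span A (row j A) B.
Proof.
pose full B := forall j, in_span A (row j A) B.
have /choice[p hp] B : exists p : {poly R}, p != 0 /\
    forall t, ~ full B -> in_span A ((\row_(j < q) t ^+ j) *m A) B -> root p t.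
  have [fB|/existsNP[j /separation[w jw wB]]] := pselect (full B).
    by exists 1; rewrite oner_eq0.
  (* Its value at [t] pairs the curve point with [w], hence is 0 when that point is in the span of
     [B]; its coefficient at [j] is 1, so it is a nonzero polynomial. *)
  exists (\sum_(i < q) (A *m w) i 0 *: 'X^i); split.
    apply/eqP => /polyP/(_ j); rewrite coef0 coef_sum (bigD1 j) //= big1 => [|i ij].
      rewrite coefZ coefXn eqxx mulr1 addr0 => /eqP.
      by move: jw; rewrite -row_mul mxE => ->; rewrite oner_eq0.
    by rewrite coefZ coefXn (inj_eq val_inj) eq_sym (negbTE ij) mulr0.
  move=> t _ [a aB ca]; apply/rootP; rewrite horner_sum.
  transitivity (((\row_(j < q) t ^+ j) *m A *m w) 0 0).
    rewrite mulmx_eval_sum; apply: eq_bigr => i _.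
    by rewrite hornerZ hornerXn [X in _ = X * _]mxE mulrC.
  rewrite ca mulmx_eval_sum big1 // => i _.
  by case: (boolP (i \in B)) => [/wB|/aB] ->; rewrite ?mulr0 ?mul0r.
have [|t] := @exists_nonroot R (\prod_(B : {set 'I_q}) p B).
  by apply/prodf_neq0 => B _; case: (hp B).
rewrite rootE horner_prod => /prodf_neq0 tP.
exists ((\row_(j < q) t ^+ j) *m A).
  by eexists; last reflexivity; move=> j; rewrite inE.
move=> B cB; apply: contrapT => fB; have /negP := tP B isT; apply.
by apply/eqP/rootP; apply: (hp B).2.
Qed.
End Generic.

(** * Counting the sets of size k in disjoint intervals *)

Lemma card_bigcup_leq (T I : finType) (P : pred I) (F : I -> {set T}) :
  (#|\bigcup_(i | P i) F i| <= \sum_(i | P i) #|F i|)%N.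
Proof.
elim/big_rec2: _ => [|i k A _ leA]; first by rewrite cards0.
by rewrite (leq_trans (leq_card_setU _ _)) // leq_add2l.
Qed.

Section Counting.
Variable T : finType.
Implicit Types (B D E S : {set T}) (k m n : nat).

Definition between k D B := [set S : {set T} | [&& D \subset S, S \subset B & #|S| == k]].

(** Removing [D] gives a bijection onto the subsets of [B :\: D] of size [k - #|D|]. *)
Lemma card_between k D B : D \subset B -> (#|D| <= k)%N ->
  #|between k D B| = 'C(#|B| - #|D|, k - #|D|).
Proof.
move=> DB Dk; rewrite -cardsDS // -cards_draws.
rewrite -(@card_in_imset _ _ (fun S => S :\: D) (between k D B)).
  apply: eq_card => S; rewrite inE; apply/imsetP/andP.
    case=> S'; rewrite inE => /and3P[DS SB /eqP <-] ->.
    by rewrite setSD // cardsDS.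
  case=> SBD /eqP cS; exists (S :|: D).
    rewrite inE subsetUr subUset DB (subset_trans SBD (subsetDl _ _)) /=.
    rewrite cardsU cS (_ : S :&: D = set0) ?cards0; first by rewrite subn0 subnK.
    by apply/eqP; rewrite setI_eq0 disjoint_sym; move: SBD; rewrite subsetD disjoint_sym => /andP[].
  rewrite setDUl setDv setU0; apply/esym/setDidPl.
  by move: SBD; rewrite subsetD => /andP[].
move=> S S'; rewrite !inE => /and3P[DS _ _] /and3P[DS' _ _] eqD.
by rewrite -(setID S D) -(setID S' D) eqD (setIidPr DS) (setIidPr DS').
Qed.

(** [P] abstracts the set of pairs [(B, D)] satisfying [facet]; the hypotheses below keep only the
    combinatorics of vertices. *)
Variables (neg : T -> T) (n : nat) (P : {set {set T} * {set T}}).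
Hypothesis negK : involutive neg.
Hypothesis P_sub : forall x, x \in P -> x.2 \subset x.1.
Hypothesis P_card : forall x, x \in P -> (#|x.1| <= n)%N.
Hypothesis P_opp : forall x, x \in P -> (neg @: x.1, neg @: (x.1 :\: x.2)) \in P.
Hypothesis P_uniq : forall x y E, x \in P -> y \in P ->
  x.2 \subset E -> E \subset x.1 -> y.2 \subset E -> E \subset y.1 -> x = y.

Let inj := inv_inj negK.
Let opp (x : {set T} * {set T}) := (neg @: x.1, neg @: (x.1 :\: x.2)).

Lemma opp_inj x y : x \in P -> y \in P -> opp x = opp y -> x = y.
Proof.
case: x y => [B D] [B' D'] /P_sub /= DB /P_sub /= DB'.
case=> /(imset_inj inj) eqB /(imset_inj inj) eqD; congr (_, _) => //.
have setDDK (E F : {set T}) : F \subset E -> E :\: (E :\: F) = F.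
  by move=> FE; rewrite setDDr setDv set0U (setIidPr FE).
by rewrite -(setDDK _ _ DB) -(setDDK _ _ DB') eqD eqB.
Qed.

(** With [b = #|B|] and [d = #|D|], the two sides are ['C(b - d, b - k)] and ['C(d, b - k)], and
    [b - d < d]. *)
Lemma card_between_opp k x : x \in P -> (#|x.1| < #|x.2|.*2)%N ->
  (#|between k x.2 x.1| <= #|between k (opp x).2 (opp x).1|)%N.
Proof.
case: x => B D xP /= lt; have DB := P_sub xP; rewrite /= in DB.
have DlB := subset_leq_card DB.
have [->|[S]] := set_0Vmem (between k D B); first by rewrite cards0.
rewrite inE => /and3P[/subset_leq_card DS /subset_leq_card SB /eqP cS].
rewrite cS in DS SB.
rewrite !card_between ?imsetS ?subsetDl // !card_imset // ?cardsDS //; last first.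
  by rewrite leq_subLR; lia.
rewrite -bin_sub ?leq_sub2r // -(bin_sub (n := #|B| - (#|B| - #|D|))); last by lia.
rewrite (_ : (#|B| - #|D| - (k - #|D|) = #|B| - k)%N); last by lia.
rewrite (_ : (#|B| - (#|B| - #|D|) - (k - (#|B| - #|D|)) = #|B| - k)%N); last by lia.
by apply: leq_bin2l; lia.
Qed.

(** [opp] maps the pairs with large [D] injectively to pairs with small [D], and no term
    decreases. *)
Lemma sum_between_half k : (\sum_(x in P) #|between k x.2 x.1| <=
  (\sum_(x in P | #|x.2|.*2 <= #|x.1|) #|between k x.2 x.1|).*2)%N.
Proof.
rewrite (bigID (fun x : {set T} * {set T} => #|x.2|.*2 <= #|x.1|)%N) /= -addnn leq_add2l.
pose Q := [set x in P | (#|x.1| < #|x.2|.*2)%N].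
have QP x : x \in Q -> x \in P by rewrite inE => /andP[].
rewrite (eq_bigl (fun x => x \in Q)) => [|x]; last by rewrite !inE ltnNge.
apply: (@leq_trans (\sum_(x in Q) #|between k (opp x).2 (opp x).1|)).
  by apply: leq_sum => x; rewrite [_ \in Q]inE => /andP[xP xlt]; apply: card_between_opp.
rewrite -(big_imset (fun x => #|between k x.2 x.1|) (h := opp)) /=; last first.
  by move=> x y /QP xP /QP yP; apply: opp_inj.
rewrite [X in (X <= _)%N]big_mkcond [X in (_ <= X)%N]big_mkcond.
apply: leq_sum => y _; case: ifP => [/imsetP[x]|//]; rewrite inE => /andP[xP xlt] ->.
rewrite (P_opp xP) /opp /= !card_imset // cardsDS ?P_sub //.
by rewrite doubleB leq_subLR -addnn leq_add2r (ltnW xlt).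
Qed.

(** Each set [S] counted for a small [D] is charged to some [E] of size [m] with
    [D \subset E \subset S]. Such an [E] determines the pair [(B, D)], and leaves at most
    ['C(n - m, k - m)] choices for [S]. *)
Lemma sum_between_leq (V : {set {set T}}) m k : m = n./2 -> (m <= k)%N ->
  (forall x E, x \in P -> E \subset x.1 -> #|E| = m -> E \in V) ->
  (\sum_(x in P) #|between k x.2 x.1| <= (#|V| * 'C(n - m, k - m)).*2)%N.
Proof.
move=> mn mk PV; rewrite (leq_trans (sum_between_half k)) // leq_double.
pose mid (x : {set T} * {set T}) E := (x.2 \subset E) && (E \subset x.1).
apply: (@leq_trans (\sum_(x in P) \sum_(E in V | mid x E && (#|E| == m))
    #|between k E x.1|)).
  rewrite [X in (X <= _)%N]big_mkcondr; apply: leq_sum => -[B D] xP /=.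
  case: ifP => // le; apply: (leq_trans _ (card_bigcup_leq _ _)).
  apply/subset_leq_card/fintype.subsetP => S; rewrite inE => /and3P[DS SB /eqP cS].
  have := P_card xP; rewrite /= => Bn.
  (* Here [#|D|.*2 <= #|B| <= n] gives [#|D| <= m], so an intermediate [E] exists. *)
  have : (0 < #|between m D S|)%N.
    by rewrite card_between // ?bin_gt0 ?cS ?leq_sub2r //; lia.
  case/card_gt0P => E; rewrite inE => /and3P[DE ES cE].
  apply/bigcupP; exists E; last by rewrite inE ES SB cS eqxx.
  have EB := subset_trans ES SB.
  by rewrite (PV (B, D)) ?(eqP cE) //= /mid DE EB eqxx.
rewrite (exchange_big_dep (mem V)) //=; last by move=> x E _ /andP[].
rewrite -sum_nat_const; apply: leq_sum => E EV.
(* By [P_uniq] the inner sum has at most one term. *)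
have [x /and3P[xP /andP[xE Ex] /eqP cE]|none] :=
  pickP (fun x => [&& x \in P, mid x E & #|E| == m]); last first.
  by rewrite big1 // => x /andP[xP /andP[_ h]]; have := none x; rewrite xP h.
rewrite (big_pred1 x) => [|y].
  rewrite card_between // cE ?leq_bin2l // leq_sub2r //.
  exact: P_card.
rewrite EV /= cE eqxx andbT; apply/andP/eqP => [[yP /andP[yE Ey]]|->].
  exact: (P_uniq yP xP yE Ey).
by rewrite xP /mid xE.
Qed.

End Counting.

Lemma card_faces_leq (R : realFieldType) (q n : nat) (A : 'M[R]_(q, n))
    (neg : 'I_q -> 'I_q) (V : {set {set 'I_q}}) (k m : nat) :
  involutive neg -> (forall j l, A (neg j) l = - A j l) -> simple_polyhedron A ->
  m = n./2 -> (m <= k)%N ->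
  (forall E, is_face A E -> #|E| = m -> E \in V) ->
  (#|[set S : {set 'I_q} | `[< is_face A S >] & #|S| == k]|
     <= (#|V| * 'C(n - m, k - m)).*2)%N.
Proof.
move=> negK negA sA mn mk VE; have [c cT cG] := exists_generic A.
pose P := [set x : {set 'I_q} * {set 'I_q} | `[< facet A c x.1 x.2 >]].
have inP x : x \in P -> facet A c x.1 x.2 by rewrite inE => /asboolP.
apply: (@leq_trans (\sum_(x in P) #|between k x.2 x.1|)).
  apply: (leq_trans _ (card_bigcup_leq _ _)).
  apply/subset_leq_card/fintype.subsetP => S; rewrite inE => /andP[/asboolP].
  move=> /(face_in_facet negA cT sA)[B [D [BD DS SB]]] cS.
  apply/bigcupP; exists (B, D); first by rewrite inE; apply/asboolP.
  by rewrite inE DS SB.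
apply: (sum_between_leq negK) => //.
- by move=> x /inP /facet_sub.
- by move=> x /inP /facet_card; apply.
- move=> x /inP xP; rewrite inE; apply/asboolP.
  exact: (facet_opp negA sA cG negK).
- move=> [B D] [B' D'] E /inP xP /inP yP /= DE EB DE' EB'.
  by have /= [-> ->] := facet_uniq sA cG xP yP DE EB DE' EB'.
- move=> x E /inP[r [a [rQ xr _ _ _]]] Ex; apply: VE.
  by exists r; rewrite ?xr.
Qed.

(** * Signed models and signed permutations *)

(** List the elements of [A] and then those of its complement, do the same for [B], and match the
    two lists position by position. *)
Lemma exists_perm_imset (T : finType) (A B : {set T}) : #|A| = #|B| ->
  exists s : {perm T}, s @: A = B.
Proof.
move=> cAB; have cCAB : #|~: A| = #|~: B|.
  by apply/eqP; rewrite -(eqn_add2l #|A|) cardsC {1}cAB cardsC.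
have [|T0] := posnP #|T|.
  move=> /card0_eq T0; exists 1%g; apply/setP => x; by have := T0 x; rewrite inE.
have [x0 _] : exists x0 : T, true by move/card_gt0P: T0 => [x0 _]; exists x0.
pose e (A : {set T}) := enum A ++ enum (~: A).
have eu C : uniq (e C).
  rewrite cat_uniq !enum_uniq andbT /=; apply/hasPn => x.
  by rewrite !mem_enum inE.
have eT C x : x \in e C by rewrite mem_cat !mem_enum inE orbN.
have se C : size (e C) = #|T| by rewrite size_cat -!cardE cardsC.
pose f x := nth x0 (e B) (index x (e A)).
have finj : injective f.
  move=> x y /eqP; rewrite nth_uniq ?eu ?se -?(se A) ?index_mem //.
  by move=> /eqP eq; rewrite -(nth_index x0 (eT A x)) eq nth_index.
exists (perm finj); apply/eqP; rewrite eqEcard card_imset; last exact: perm_inj.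
rewrite cAB leqnn andbT; apply/fintype.subsetP => _ /imsetP[x xA ->].
rewrite permE /f /e index_cat mem_enum xA nth_cat.
have lt : (index x (enum A) < size (enum B))%N by rewrite -cardE -cAB cardE index_mem mem_enum.
by rewrite lt -mem_enum mem_nth.
Qed.

Section SignedIndex.
Variable p : nat.
Implicit Types (A B : {set 'I_p}) (i : 'I_p) (j : 'I_(p + p)) (S : {set 'I_(p + p)}).

(** A signed index is handled as a column of [X0] with a sign; the right half of ['I_(p + p)] holds
    the columns of [- X0]. *)
Definition index_abs j : 'I_p := match split j with inl i => i | inr i => i end.
Definition index_neg j : bool := if split j is inr _ then true else false.
Definition signed_index i (b : bool) : 'I_(p + p) := if b then rshift p i else lshift p i.
Definition index_opp j := signed_index (index_abs j) (~~ index_neg j).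

Lemma signed_indexK j : signed_index (index_abs j) (index_neg j) = j.
Proof. by rewrite /index_abs /index_neg -[RHS]splitK; case: split. Qed.

Lemma index_absE i b : index_abs (signed_index i b) = i.
Proof. by rewrite /index_abs; case: b; rewrite ?(unsplitK (inl i)) ?(unsplitK (inr i)). Qed.

Lemma index_negE i b : index_neg (signed_index i b) = b.
Proof. by rewrite /index_neg; case: b; rewrite ?(unsplitK (inl i)) ?(unsplitK (inr i)). Qed.

Lemma index_oppK : involutive index_opp.
Proof. by move=> j; rewrite /index_opp index_absE index_negE negbK signed_indexK. Qed.

(** Only such models can be faces: two opposite columns cannot both have product 1 with the same
    [r]. *)
Definition antipodal_free S := [forall j in S, index_opp j \notin S].

Lemma antipodal_free_abs S : antipodal_free S -> {in S &, injective index_abs}.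
Proof.
move=> /forall_inP afS j j' jS j'S eqa.
rewrite -[j]signed_indexK -[j']signed_indexK eqa; congr signed_index.
apply/eqP; apply: contraTT (afS _ jS) => neq; rewrite negbK.
rewrite /index_opp eqa (_ : ~~ index_neg j = index_neg j') ?signed_indexK //.
by move: neq; case: index_neg; case: index_neg.
Qed.

(** Coordinates on antipodal-free models: [A] is the set of columns used, and [B] the set of those
    used with a minus sign. *)
Definition signed_set (A B : {set 'I_p}) : {set 'I_(p + p)} :=
  [set j | (index_abs j \in A) && (index_neg j == (index_abs j \in B))].

Lemma signed_setP S : antipodal_free S ->
  S = signed_set (index_abs @: S) [set i | signed_index i true \in S].
Proof.
move=> afS; have abs_inj := antipodal_free_abs afS.
apply/setP => j; rewrite !inE; apply/idP/andP => [jS|[/imsetP[j' j'S eqa]]].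
  split; first exact: imset_f.
  rewrite -[j]signed_indexK in jS; case: (index_neg j) jS => [->//|jS].
  rewrite eq_sym; apply/eqP/negbTE; have /forall_inP/(_ _ jS) := afS.
  by rewrite /index_opp index_absE index_negE.
move=> /eqP negj; suff -> : j = j' by [].
rewrite -[j]signed_indexK -[j']signed_indexK eqa; congr signed_index.
rewrite negj eqa; have /forall_inP/(_ _ j'S) := afS; move: j'S.
rewrite -{1}[j']signed_indexK /index_opp.
by case: (index_neg j') => [->|_ /negbTE].
Qed.

Lemma signed_set_abs A B : index_abs @: signed_set A B = A.
Proof.
apply/setP => i; apply/imsetP/idP => [[j]|iA]; first by rewrite inE => /andP[? _] ->.
by exists (signed_index i (i \in B)); rewrite ?inE !index_absE // iA index_negE /=.
Qed.

Lemma antipodal_free_signed_set A B : antipodal_free (signed_set A B).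
Proof.
apply/forall_inP => j; rewrite !inE index_absE index_negE => /andP[-> /eqP ->] /=.
by case: (_ \in B).
Qed.

Lemma signed_set_neg A B : B \subset A ->
  [set i | signed_index i true \in signed_set A B] = B.
Proof.
move=> BA; apply/setP => i; rewrite !inE index_absE index_negE eq_sym eqb_id.
by case: (boolP (i \in B)) => [iB|]; rewrite ?andbF // (fintype.subsetP BA _ iB).
Qed.

Definition signed_models (k : nat) : {set {set 'I_(p + p)}} :=
  [set S | antipodal_free S & #|S| == k].

Lemma card_signed_models k : #|signed_models k| = ('C(p, k) * 2 ^ k)%N.
Proof.
pose D := [set x : {set 'I_p} * {set 'I_p} | (x.2 \subset x.1) && (#|x.1| == k)].
have -> : signed_models k = [set signed_set x.1 x.2 | x in D].
  apply/setP => S; rewrite inE; apply/andP/imsetP => [[afS cS]|[[A B]]].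
    exists (index_abs @: S, [set i | signed_index i true \in S]); last exact: signed_setP.
    rewrite inE card_in_imset ?cS ?andbT /=; last exact: antipodal_free_abs.
    by apply/fintype.subsetP => i; rewrite inE => iS; rewrite -(index_absE i true) imset_f.
  rewrite inE => /andP[/= BA cA] ->; rewrite antipodal_free_signed_set; split=> //.
  rewrite -(card_in_imset (antipodal_free_abs (antipodal_free_signed_set A B))).
  by rewrite signed_set_abs.
rewrite card_in_imset => [|[A B] [A' B']]; last first.
  rewrite !inE => /andP[/= BA _] /andP[/= BA' _] eqS.
  congr (_, _); first by rewrite -(signed_set_abs A B) eqS signed_set_abs.
  by rewrite -(signed_set_neg BA) eqS signed_set_neg.
rewrite -sum1_card (eq_bigl (fun x : {set 'I_p} * {set 'I_p} =>
  (#|x.1| == k) && (x.2 \subset x.1))); last first.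
  by move=> x; rewrite inE andbC.
rewrite -(pair_big_dep (fun A : {set 'I_p} => #|A| == k)
  (fun A B : {set 'I_p} => B \subset A) (fun _ _ => 1%N)) /=.
have -> : 'C(p, k) = #|[set A : {set 'I_p} | #|A| == k]| by rewrite card_draws card_ord.
rewrite -sum_nat_const.
rewrite [RHS](eq_bigl (fun A : {set 'I_p} => #|A| == k)) => [|A]; last by rewrite inE.
apply: eq_bigr => A /eqP <-; rewrite sum1dep_card -card_powerset.
by apply: eq_card => B; rewrite !inE.
Qed.

Definition signed_perm (s : {perm 'I_p}) (e : 'I_p -> bool) j :=
  signed_index (s (index_abs j)) (index_neg j (+) e (index_abs j)).

Lemma signed_perm_surj s e j : exists j', signed_perm s e j' = j.
Proof.
exists (signed_index (s^-1 (index_abs j))%g (index_neg j (+) e (s^-1 (index_abs j))%g)).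
by rewrite /signed_perm index_absE index_negE permKV addbK signed_indexK.
Qed.

Lemma signed_perm_inj s e : injective (signed_perm s e).
Proof.
move=> j j' eqg; rewrite -[j]signed_indexK -[j']signed_indexK.
have eqa : index_abs j = index_abs j'.
  by have := congr1 index_abs eqg; rewrite !index_absE => /perm_inj.
have := congr1 index_neg eqg; rewrite !index_negE eqa => /addIb ->.
by [].
Qed.

Lemma signed_perm_trans k S S' : S \in signed_models k -> S' \in signed_models k ->
  exists s e, signed_perm s e @: S = S'.
Proof.
rewrite !inE => /andP[afS /eqP cS] /andP[afS' /eqP cS'].
have [|s sS] := @exists_perm_imset _ (index_abs @: S) (index_abs @: S').
  by rewrite !card_in_imset ?cS ?cS' //; apply: antipodal_free_abs.
pose neg S i := signed_index i true \in S.
(* Flip a column exactly when its sign in [S] differs from the sign of its image in [S']. *)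
exists s, (fun i => neg S i (+) neg S' (s i)).
apply/eqP; rewrite eqEcard card_imset; last exact: signed_perm_inj.
rewrite cS cS' leqnn andbT; apply/fintype.subsetP => _ /imsetP[j jS ->].
suff : signed_perm s (fun i => neg S i (+) neg S' (s i)) j
    \in signed_set (index_abs @: S') [set i | signed_index i true \in S'].
  by rewrite -signed_setP.
rewrite inE index_absE index_negE -sS imset_f ?imset_f //= inE -/(neg S' _).
have : j \in signed_set (index_abs @: S) [set i | signed_index i true \in S].
  by rewrite -signed_setP.
rewrite inE => /andP[_ /eqP ->]; rewrite inE -/(neg S _).
by rewrite addKb.
Qed.

End SignedIndex.

(* Imported only here because [classical_sets] hides the names of [finset]. *)
From mathcomp Require Import all_classical all_reals all_analysis.
From mathcomp Require Import measurable_realfun.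

Import numFieldNormedType.Exports.

Local Open Scope classical_set_scope.
Local Open Scope ring_scope.

(** * First order conditions for the lasso *)

Section KKT.
Variable R : realType.

Lemma sqnorm2_ge0 (n : nat) (v : 'cV[R]_n) : 0 <= sqnorm2 v.
Proof. by apply: sumr_ge0 => i _; apply: sqr_ge0. Qed.

Lemma sqnorm2Z (n : nat) (t : R) (v : 'cV[R]_n) : sqnorm2 (t *: v) = t ^+ 2 * sqnorm2 v.
Proof. by rewrite /sqnorm2 mulr_sumr; apply: eq_bigr => i _; rewrite mxE exprMn. Qed.

Lemma sqnorm2_residual (n m : nat) (X : 'M[R]_(n, m)) (r : 'cV[R]_n) (d : 'cV[R]_m) :
  sqnorm2 (r - X *m d)
    = sqnorm2 r - 2 * (\sum_j d j 0 * (X^T *m r) j 0) + sqnorm2 (X *m d).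
Proof.
have -> : \sum_j d j 0 * (X^T *m r) j 0 = \sum_i r i 0 * (X *m d) i 0.
  under eq_bigr do rewrite mxE mulr_sumr.
  rewrite exchange_big /=; apply: eq_bigr => i _; rewrite mxE mulr_sumr.
  by apply: eq_bigr => j _; rewrite mxE; ring.
rewrite /sqnorm2 mulr_sumr -sumrB -big_split /=; apply: eq_bigr => i _.
by rewrite !mxE; ring.
Qed.

(** The objective is quadratic, so its Taylor expansion at [b] is exact; both directions of the
    first order conditions are read off from it. *)
Lemma signed_objectiveD (n p : nat) (X0 : 'M[R]_(n, p)) (lambda : R) (y : 'cV[R]_n)
    (b d : 'cV[R]_(p + p)) (X := signed_design X0) :
  signed_objective X0 lambda y (b + d) = signed_objective X0 lambda y b
    + 2^-1 * sqnorm2 (X *m d) + \sum_j d j 0 * (lambda - (X^T *m (y - X *m b)) j 0).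
Proof.
rewrite /signed_objective -/X mulmxDr opprD addrA (sqnorm2_residual X (y - X *m b)).
under [\sum_j (b + d) j 0]eq_bigr do rewrite mxE.
under [\sum_j d j 0 * (lambda - _)]eq_bigr do rewrite mulrBr.
by rewrite sumrB big_split /= -mulr_suml; field.
Qed.

Lemma slope_ge0 (a g delta : R) : 0 <= a -> 0 < delta ->
  (forall t, 0 <= t <= delta -> 0 <= t ^+ 2 * a + t * g) -> 0 <= g.
Proof.
move=> a0 d0 h; rewrite leNgt; apply/negP => g0.
(* This [t] gives [t * a + g <= - t < 0], against the hypothesis at [t]. *)
pose t := Num.min delta (- g / (a + 1)).
have t0 : 0 < t by rewrite lt_min d0 divr_gt0 ?oppr_gt0 //; lra.
have /h : 0 <= t <= delta by rewrite (ltW t0) ge_min lexx.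
have : t * (a + 1) <= - g by rewrite -ler_pdivlMr ?ge_min ?lexx ?orbT //; lra.
nra.
Qed.

Lemma model_region_eq0 (n p : nat) (X0 : 'M[R]_(n, p)) (lambda : R)
    (S : {set 'I_(p + p)}) : 0 < lambda ->
  model_region X0 lambda S = set0 <-> ~ is_face (signed_design X0)^T S.
Proof.
move=> l0; set X := signed_design X0; split=> [/seteqP[sub _] [r rQ Sr]|nface].
  (* For the response [lambda *: r + X *m b] the residual at [b] is [lambda *: r], so every first
     order term is nonnegative. *)
  pose b : 'cV[R]_(p + p) := \col_j (j \in S)%:R.
  apply: (sub (lambda *: r + X *m b)); exists b; split; last first.
    by apply/setP => j; rewrite inE mxE ltr0n lt0b.
  split=> [j|b' b'0]; first by rewrite mxE ler0n.
  rewrite -[b'](addrNK b) [b' - b + b]addrC signed_objectiveD -/X -addrA lerDl.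
  rewrite addr_ge0 ?mulr_ge0 ?invr_ge0 ?sqnorm2_ge0 //.
  apply: sumr_ge0 => j _; rewrite addrK -scalemxAr [X in lambda - X]mxE.
  have -> : (b' - b) j 0 = b' j 0 - (j \in S)%:R by rewrite !mxE.
  have -> : lambda - lambda * ((X^T *m r) j 0) = lambda * (1 - (X^T *m r) j 0).
    by rewrite mulrBr mulr1.
  case: (boolP (j \in S)) => jS.
    have := fintype.subsetP Sr _ jS; rewrite inE => /eqP ->.
    by rewrite subrr !mulr0.
  by rewrite subr0 mulr_ge0 // mulr_ge0 ?(ltW l0) // subr_ge0.
apply/seteqP; split=> // y [b [[b0 bmin] bS]]; apply: nface.
pose r := y - X *m b.
(* One-sided derivative at [b] in the direction [s] times the [j]-th unit vector: [s = 1] is always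
   admissible, and [s = -1] is when [b j 0] is positive. *)
have slope j delta (s : R) : s ^+ 2 = 1 -> 0 < delta ->
    (forall t, 0 <= t <= delta -> 0 <= b j 0 + t * s) ->
    0 <= s * (lambda - (X^T *m r) j 0).
  move=> s1 delta0 tb.
  apply: (@slope_ge0 (2^-1 * sqnorm2 (X *m delta_mx j 0)) _ delta) => //.
    by rewrite mulr_ge0 ?invr_ge0 ?sqnorm2_ge0.
  move=> t td; have := bmin (b + (t * s) *: delta_mx j 0).
  rewrite signed_objectiveD -/X -/r -addrA lerDl => h.
  have -> : t ^+ 2 * (2^-1 * sqnorm2 (X *m delta_mx j 0)) =
      2^-1 * sqnorm2 (X *m ((t * s) *: delta_mx j 0)).
    by rewrite -scalemxAr sqnorm2Z exprMn s1; ring.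
  have -> : t * (s * (lambda - (X^T *m r) j 0)) =
      \sum_i ((t * s) *: delta_mx j 0 : 'cV[R]_(p + p)) i 0
        * (lambda - (X^T *m r) i 0).
    rewrite (bigD1 j) //= big1 ?addr0 => [|i ij]; first by rewrite !mxE !eqxx mulr1 mulrA.
    by rewrite !mxE (negbTE ij) mulr0 mul0r.
  apply: h => i; rewrite !mxE; case: (eqVneq i j) => [->|ij]; first by rewrite mulr1 tb.
  by rewrite mulr0 addr0.
have Xr j : (X^T *m r) j 0 <= lambda.
  rewrite -subr_ge0 -[_ - _]mul1r; apply: (slope j 1); rewrite ?expr1n ?ltr01 //.
  by move=> t /andP[t0 _]; rewrite mulr1 addr_ge0.
exists (lambda^-1 *: r).
  by move=> j; rewrite -scalemxAr mxE mulrC ler_pdivrMr // mul1r.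
apply/fintype.subsetP => j; rewrite -bS !inE => bj.
rewrite -scalemxAr mxE mulrC (_ : (X^T *m r) j 0 = lambda) ?divff ?lt0r_neq0 //.
apply/eqP; rewrite eq_le Xr -subr_le0 -oppr_ge0 -mulN1r /=.
apply: (slope j (b j 0)) => //; first by rewrite sqrrN expr1n.
by move=> t /andP[_ tb]; rewrite mulrN1 subr_ge0.
Qed.

(** The hypotheses say that [X0^T *m r] is [lambda] times a subgradient of [norm1] at [b], which
    suffices by convexity. *)
Lemma lasso_minimizer_suff (n p : nat) (X0 : 'M[R]_(n, p)) (lambda : R)
    (r : 'cV[R]_n) (b : 'cV[R]_p) : 0 < lambda ->
  (forall j, `|(X0^T *m r) j 0| <= lambda) ->
  (forall j, b j 0 * (X0^T *m r) j 0 = lambda * `|b j 0|) ->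
  lasso_minimizer X0 lambda (r + X0 *m b) b.
Proof.
move=> l0 rQ br b'; rewrite /lasso_objective addrK.
have -> : r + X0 *m b - X0 *m b' = r - X0 *m (b' - b).
  by rewrite mulmxBr opprB addrA.
rewrite sqnorm2_residual -subr_ge0 /norm1.
have descent (s t t' v q : R) : 0 <= q -> s <= lambda * t' ->
    0 <= 2^-1 * (v - 2 * (s - lambda * t) + q) + lambda * t' - (2^-1 * v + lambda * t).
  by lra.
have -> : \sum_j (b' - b) j 0 * (X0^T *m r) j 0 =
    \sum_j b' j 0 * (X0^T *m r) j 0 - lambda * \sum_j `|b j 0|.
  rewrite mulr_sumr -sumrB; apply: eq_bigr => j _.
  by rewrite -br -mulrBl !mxE.
apply: descent; first exact: sqnorm2_ge0.
rewrite mulr_sumr ler_sum // => j _.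
by rewrite (le_trans (ler_norm _)) // normrM mulrC ler_wpM2r.
Qed.

(** Start from the sign vector [s] of the tight columns. Adding a small multiple of the dependency
    [a] changes neither the fit nor the sign pattern required for optimality, so uniqueness forces
    [a = 0]. *)
Lemma lasso_unique_tight (n p : nat) (X0 : 'M[R]_(n, p)) (lambda : R)
    (r : 'cV[R]_n) (a : 'cV[R]_p) : 0 < lambda -> lasso_unique X0 lambda ->
  (forall j, `|(X0^T *m r) j 0| <= 1) ->
  (forall j, `|(X0^T *m r) j 0| != 1 -> a j 0 = 0) ->
  X0 *m a = 0 -> a = 0.
Proof.
move=> l0 uni rQ at0 Xa.
pose s : 'cV[R]_p := \col_j (if `|(X0^T *m r) j 0| == 1 then (X0^T *m r) j 0 else 0).
(* Small enough that [e * a] has entries of absolute value at most 1, so that no entry of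
   [s + t *: a] takes the wrong sign. *)
pose e := (1 + \sum_j `|a j 0|)^-1.
have sum0 : 0 <= \sum_j `|a j 0| by apply: sumr_ge0.
have e0 : 0 < e by rewrite invr_gt0; lra.
have minz t : 0 <= t <= e -> lasso_minimizer X0 lambda (lambda *: r + X0 *m s) (s + t *: a).
  move=> /andP[t0 te]; have -> : X0 *m s = X0 *m (s + t *: a).
    by rewrite mulmxDr -scalemxAr Xa scaler0 addr0.
  apply: lasso_minimizer_suff => // j; rewrite -scalemxAr mxE.
    by rewrite normrM gtr0_norm // ler_piMr // ltW.
  rewrite mxE [X in _ * X]mxE [X in _ + X]mxE.
  case: ifPn => [/eqP rj|/at0 ->]; last by rewrite mulr0 addr0 normr0 mul0r mulr0.
  rewrite mulrCA; congr (_ * _).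
  have ta : `|t * a j 0| <= 1.
    rewrite normrM ger0_norm //; apply: (@le_trans _ _ (e * `|a j 0|)).
      by rewrite ler_wpM2r.
    rewrite mulrC ler_pdivrMr ?mul1r; last by lra.
    by rewrite (bigD1 j) //= ler_wpDl // lerDl sumr_ge0.
  move: rj ta; set x := (X0^T *m r) j 0; set z := t * a j 0.
  rewrite ler_norml => xE /andP[z1 z2].
  case: (ger0P x) xE => _ xE; first by rewrite xE mulr1 ger0_norm //; lra.
  by rewrite -[x]opprK xE mulrN1 ler0_norm //; lra.
have [b [bmin buniq]] := uni (lambda *: r + X0 *m s).
have s0 : b = s + 0 *: a by apply: buniq; apply: minz; rewrite lexx ltW.
have /eqP : s + 0 *: a = s + e *: a.
  by rewrite -s0; apply: buniq; apply: minz; rewrite lexx ltW.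
rewrite scale0r addr0 -[X in X == _]addr0 (inj_eq (addrI _)) eq_sym scaler_eq0.
by rewrite gt_eqF //= => /eqP.
Qed.

End KKT.

(** * Faces of the signed design *)

Section SignedFaces.
Variables (R : realType) (n p : nat).
Implicit Types (X : 'M[R]_(n, p)) (S : {set 'I_(p + p)}).

Definition signed_face X S : Prop := is_face (signed_design X)^T S.

Lemma signed_designE X (l : 'I_n) (j : 'I_(p + p)) :
  signed_design X l j = (-1) ^+ index_neg j * X l (index_abs j).
Proof.
rewrite /signed_design mxE /index_neg /index_abs; case: fintype.split => i; first by rewrite mul1r.
by rewrite mxE mulN1r.
Qed.

Lemma signed_design_opp X (j : 'I_(p + p)) (l : 'I_n) :
  (signed_design X)^T (index_opp j) l = - (signed_design X)^T j l.
Proof.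
rewrite mxE [in RHS]mxE !signed_designE index_negE index_absE signrN.
by rewrite mulNr.
Qed.

Lemma signed_mulE X (r : 'cV[R]_n) (j : 'I_(p + p)) :
  ((signed_design X)^T *m r) j 0 = (-1) ^+ index_neg j * (X^T *m r) (index_abs j) 0.
Proof.
rewrite !mxE mulr_sumr; apply: eq_bigr => l _.
by rewrite mxE signed_designE [X^T _ _]mxE mulrA.
Qed.

Lemma signed_face_antipodal_free X S : signed_face X S -> antipodal_free S.
Proof.
case=> r _ Sr; apply/forall_inP => j jS; apply/negP => ojS.
have := fintype.subsetP Sr _ jS; have := fintype.subsetP Sr _ ojS.
rewrite !inE (mulmx_neg (signed_design_opp X)) => /eqP h /eqP h'; lra.
Qed.

(** A dependency among signed columns becomes one among columns of [X] by subtracting opposite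
    coefficients. The difference vanishes, and as opposite columns are never both tight, so does
    each coefficient. *)
Lemma lasso_unique_simple X (lambda : R) : 0 < lambda -> lasso_unique X lambda ->
  simple_polyhedron (signed_design X)^T.
Proof.
move=> l0 uni r rQ a ar aA.
have rX i : `|(X^T *m r) i 0| <= 1.
  rewrite ler_norml; have := rQ (signed_index i true); have := rQ (signed_index i false).
  by rewrite !signed_mulE !index_negE !index_absE expr0 mul1r expr1 mulN1r; lra.
have tightE i b : signed_index i b \in tight (signed_design X)^T r ->
    (X^T *m r) i 0 = (-1) ^+ b.
  rewrite inE signed_mulE index_negE index_absE => /eqP /(congr1 ( *%R ((-1) ^+ b))).
  by rewrite mulrA -expr2 sqrr_sign mul1r mulr1.
pose d : 'cV[R]_p := \col_i (a 0 (signed_index i false) - a 0 (signed_index i true)).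
have d0 : d = 0.
  apply: (lasso_unique_tight l0 uni rX).
    move=> i ri; rewrite mxE !ar ?subrr //; apply: contra ri => /tightE ->.
      by rewrite normrX normrN1 expr1n.
    by rewrite normrX normrN1 expr1n.
  apply/colP => l; transitivity ((a *m (signed_design X)^T) 0 l); last by rewrite aA !mxE.
  rewrite mxE [RHS]mxE big_split_ord /= -big_split /=; apply: eq_bigr => i _.
  rewrite [d _ _]mxE [X in _ = _ * X + _]mxE [X in _ = _ + _ * X]mxE.
  rewrite !signed_designE -[lshift p i]/(signed_index i false).
  rewrite -[rshift p i]/(signed_index i true) !index_negE !index_absE.
  by rewrite expr0 expr1; ring.
apply/rowP => j; rewrite mxE -[j]signed_indexK.
set i := index_abs j; have /colP/(_ i) := d0; rewrite !mxE => /subr0_eq aft.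
suff at0 : a 0 (signed_index i true) = 0 by case: (index_neg j); rewrite ?aft.
have [/tightE i1|/ar //] := boolP (signed_index i true \in tight (signed_design X)^T r).
rewrite -aft; apply: ar; apply/negP => /tightE.
by rewrite i1 expr0 expr1; lra.
Qed.

Lemma card_signed_faces X (lambda : R) (k m : nat) : 0 < lambda ->
  lasso_unique X lambda -> m = n./2 -> (m <= k)%N ->
  (#|[set S : {set 'I_(p + p)} | `[< signed_face X S >] & #|S| == k]%SET|
    <= ('C(p, m) * 2 ^ m * 'C(n - m, k - m)).*2)%N.
Proof.
move=> l0 uni mn mk; rewrite -card_signed_models.
apply: (card_faces_leq (@index_oppK p) (signed_design_opp X)) => //.
  exact: lasso_unique_simple uni.
move=> E fE cE; rewrite inE cE eqxx andbT.
exact: signed_face_antipodal_free fE.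
Qed.

Definition signed_col_perm (s : {perm 'I_p}) (e : 'I_p -> bool) X : 'M[R]_(n, p) :=
  \matrix_(l, i) ((-1) ^+ e i * X l (s i)).

Lemma signed_face_perm (s : {perm 'I_p}) (e : 'I_p -> bool) X S :
  signed_face X (signed_perm s e @: S) <-> signed_face (signed_col_perm s e X) S.
Proof.
have mulE (r : 'cV_n) j : ((signed_design (signed_col_perm s e X))^T *m r) j 0 =
    ((signed_design X)^T *m r) (signed_perm s e j) 0.
  rewrite !signed_mulE index_negE index_absE signr_addb -mulrA; congr (_ * _).
  by rewrite !mxE mulr_sumr; apply: eq_bigr => l _; rewrite !mxE mulrA.
split=> -[r rQ Sr]; exists r.
- by move=> j; rewrite mulE.
- apply/fintype.subsetP => j jS; rewrite inE mulE.
  by have := fintype.subsetP Sr _ (imset_f _ jS); rewrite inE.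
- by move=> j; have [j' <-] := signed_perm_surj s e j; rewrite -mulE.
- apply/fintype.subsetP => _ /imsetP[j jS ->]; rewrite inE -mulE.
  by have := fintype.subsetP Sr _ jS; rewrite inE.
Qed.

End SignedFaces.

(** * Measurability and invariance in law *)

Section FaceDefect.
Variables (R : realType) (n p : nat).
Implicit Types (X : 'M[R]_(n, p)) (S : {set 'I_(p + p)}).

(* Vanishes exactly at the points witnessing that [S] is a face; [`|t| + t] is
   twice the positive part of [t]. *)
Definition face_defect X S (v : 'rV[R]_n) : R :=
  \sum_(j < p + p) let t := ((signed_design X)^T *m v^T) j 0 - 1 in
    `|t| + t + (j \in S)%:R * `|t|.

Lemma defect_term_ge0 (t : R) (b : bool) : 0 <= `|t| + t + b%:R * `|t|.
Proof. by rewrite addr_ge0 ?mulr_ge0 ?ler0n // -lerBlDr sub0r ler_normr lexx orbT. Qed.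

Lemma face_defect_ge0 X S v : 0 <= face_defect X S v.
Proof. by apply: sumr_ge0 => j _; apply: defect_term_ge0. Qed.

Lemma signed_faceP X S : signed_face X S <-> exists v, face_defect X S v = 0.
Proof.
split=> [[r rQ Sr]|[v v0]].
  exists r^T; apply: big1 => j _; rewrite /= trmxK ler0_norm ?subr_le0 // addNr add0r.
  case: (boolP (j \in S)) => jS; last by rewrite mul0r.
  by have := fintype.subsetP Sr _ jS; rewrite inE => /eqP ->; rewrite subrr oppr0 mulr0.
have term0 j : let t := ((signed_design X)^T *m v^T) j 0 - 1 in
    `|t| + t + (j \in S)%:R * `|t| = 0.
  have /psumr_eq0P := v0; apply => // i _.
  exact: defect_term_ge0.
exists v^T.
  move=> j; have /= := term0 j; set t := _ - 1 => h.
  rewrite -subr_le0 -/t leNgt; apply/negP => t0; move: h.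
  rewrite (gtr0_norm t0); have := ltW t0; have : 0 <= (j \in S)%:R * t.
    by rewrite mulr_ge0 ?ler0n ?ltW.
  lra.
apply/fintype.subsetP => j jS; have /= := term0 j; rewrite jS inE -subr_eq0.
set t := _ - 1; rewrite mul1r; have := ler_norm (- t); rewrite normrN => h1 h2.
by rewrite -normr_le0; lra.
Qed.

Lemma face_defect_continuous X S : continuous (face_defect X S).
Proof.
have lin j : continuous (fun v : 'rV[R]_n => ((signed_design X)^T *m v^T) j 0 - 1).
  rewrite (_ : (fun v => _) = fun v : 'rV[R]_n =>
    \sum_l (signed_design X)^T j l * v 0 l - 1); last first.
    by apply/funext => v; rewrite mxE; congr (_ - _); apply: eq_bigr => l _; rewrite [v^T _ _]mxE.
  move=> v; apply: continuousB; last exact: cst_continuous.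
  apply: continuous_big v => [|l _ v]; first exact: add_continuous.
  by apply: continuousM; [exact: cst_continuous|exact: coord_continuous].
have normlin j v := continuous_comp (lin j v) (@norm_continuous _ _ _).
apply: continuous_big => [|j _ v /=]; first exact: add_continuous.
have cM := continuousM (@cst_continuous _ R (j \in S)%:R v) (normlin j v).
exact: (continuousD (continuousD (normlin j v) (lin j v)) cM).
Qed.

Lemma box_compact (N : nat) : compact [set v : 'rV[R]_n | forall l, v 0 l \in `[- N%:R, N%:R]].
Proof. by apply: (@rV_compact R n (fun=> [set` `[- N%:R, N%:R]])) => l; apply: segment_compact. Qed.

(* The bound [N] lets compactness recover an exact witness from the rational
   approximate ones, so that being a face is a countable combination of
   conditions on the entries of [X]. *)
Lemma signed_face_rat X S : signed_face X S <->
  exists N : nat, forall m : nat, exists2 q : 'rV[rat]_n,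
    (forall l, ratr (q 0 l) \in `[- N%:R, N%:R : R]) &
    face_defect X S (map_mx ratr q) < m.+1%:R^-1.
Proof.
rewrite signed_faceP; split=> [[v v0]|[N hN]].
  pose M := \sum_l `|v 0 l| + 1; exists (Num.bound M) => m.
  have m0 : (0 : R) < m.+1%:R^-1 by rewrite invr_gt0.
  have /nbhs_ballP[e e0 ve] : \forall u \near v, face_defect X S u < m.+1%:R^-1.
    have := @face_defect_continuous X S v; rewrite /continuous_at v0 => /cvgr_lt; exact.
  have /choice[q qP] l : exists q : rat, ratr q \in `]v 0 l, v 0 l + Num.min e 1[.
    (* The distance below [e] keeps the defect small, and the distance below 1 keeps the entries
       within the bound [M]. *)
    by apply: rat_in_itvoo; rewrite ltrDl lt_min e0 ltr01.
  have qE l : v 0 l < ratr (q l) < v 0 l + Num.min e 1 by have := qP l; rewrite in_itv.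
  exists (\row_l q l) => [l|].
    have : `|v 0 l| + 1 <= M by rewrite lerD2r (bigD1 l) //= lerDl sumr_ge0.
    have /ltW : M < (Num.bound M)%:R.
      by rewrite archi_boundP // addr_ge0 // sumr_ge0.
    have : Num.min e 1 <= 1 by rewrite ge_min lexx orbT.
    have := qE l; have := ler_norm (v 0 l); have := ler_norm (- v 0 l); rewrite normrN.
    by rewrite mxE in_itv /=; lra.
  apply: ve; split=> // i l; rewrite ord1 !mxE /ball /= ler0_norm; last first.
    by have := qE l; lra.
  have : Num.min e 1 <= e by rewrite ge_min lexx.
  by have := qE l; lra.
pose B := [set v : 'rV[R]_n | forall l, v 0 l \in `[- N%:R, N%:R]].
(* The defect attains its minimum on the box; a positive minimum would exceed some [m.+1%:R^-1]. *)
have [||v _ vmin] := @compact_EVT_min _ R (face_defect X S) B _ (@box_compact N).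
- by have [q qN _] := hN 0%N; exists (map_mx ratr q) => l; rewrite mxE; apply: qN.
- exact/continuous_subspaceT/face_defect_continuous.
exists v; apply/eqP; rewrite eq_le face_defect_ge0 andbT leNgt; apply/negP => v0.
have [m] := ltr_add_invr v0.
have [q qN qm] := hN m; rewrite add0r => hm.
have : face_defect X S v <= face_defect X S (map_mx ratr q).
  by apply: vmin; rewrite inE => l; rewrite mxE; apply: qN.
by move/(lt_le_trans hm)/(lt_trans qm); rewrite ltxx.
Qed.

End FaceDefect.

Section MatrixSigmaAlgebra.
Variables (R : realType) (n p : nat).

Definition matrix_box (B : 'I_n -> 'I_p -> set R) : set 'M[R]_(n, p) :=
  [set X | forall l i, B l i (X l i)].

Definition matrix_boxes : set (set 'M[R]_(n, p)) :=
  [set C | exists2 B, (forall l i, measurable (B l i)) & C = matrix_box B].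

(** The product sigma-algebra, presented by a generating family closed under intersection, so that
    laws can be compared on boxes. *)
Definition measurable_matrix := g_sigma_algebraType matrix_boxes.

Lemma matrix_boxesI : setI_closed matrix_boxes.
Proof.
move=> _ _ [B mB ->] [B' mB' ->]; exists (fun l i => B l i `&` B' l i).
  by move=> l i; apply: measurableI.
apply/seteqP; split=> X /=; first by move=> [h h'] l i; split.
by move=> h; split=> l i; have [] := h l i.
Qed.

Lemma measurable_entry (l : 'I_n) (i : 'I_p) :
  measurable_fun setT (fun X : measurable_matrix => (X : 'M[R]_(n, p)) l i).
Proof.
move=> _ Y mY; rewrite setTI; apply: sub_sigma_algebra.
exists (fun l' i' => if (l' == l) && (i' == i) then Y else setT).
  by move=> l' i'; case: ifP.
apply/seteqP; split=> X /=; last by move=> /(_ l i); rewrite !eqxx.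
by move=> YX l' i'; case: ifP => // /andP[/eqP -> /eqP ->].
Qed.

Lemma measurable_signed_face (S : {set 'I_(p + p)}) :
  measurable ([set X | signed_face X S] : set measurable_matrix).
Proof.
have mdefect (v : 'rV[R]_n) :
    measurable_fun setT (fun X : measurable_matrix => face_defect (X : 'M[R]_(n, p)) S v).
  have mlin j : measurable_fun setT (fun X : measurable_matrix =>
      ((signed_design (X : 'M[R]_(n, p)))^T *m v^T) j 0 - 1).
    apply: measurable_funB; last exact: measurable_cst.
    rewrite (_ : (fun X => _) = fun X : measurable_matrix =>
        \sum_(l < n) (-1) ^+ index_neg j * (X : 'M[R]_(n, p)) l (index_abs j) * v 0 l).
      apply: measurable_sum => l; apply: measurable_funM; last exact: measurable_cst.
      by apply: measurable_funM; [exact: measurable_cst|exact: measurable_entry].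
    apply/funext => X; rewrite mxE; apply: eq_bigr => l _.
    by rewrite mxE signed_designE [v^T _ _]mxE.
  have mnorm j := measurableT_comp (@normr_measurable R setT) (mlin j).
  apply: measurable_sum => j /=; apply: measurable_funD.
    by apply: measurable_funD; [exact: mnorm|exact: mlin].
  by apply: measurable_funM; [exact: measurable_cst|exact: mnorm].
rewrite (_ : [set X | _] = \bigcup_(N : nat) \bigcap_(m : nat)
   \bigcup_(q in [set q : 'rV[rat]_n | forall l, ratr (q 0 l) \in `[- N%:R, N%:R : R]])
     [set X | face_defect (X : 'M[R]_(n, p)) S (map_mx ratr q) < m.+1%:R^-1]).
  apply: bigcup_measurable => N _; apply: bigcapT_measurable => m.
  rewrite bigcup_mkcond; apply: countable_bigcupT_measurable => [|q]; first exact: countableP.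
  case: ifP => // _.
  have := mdefect (map_mx ratr q) measurableT _ (measurable_itv `]-oo, m.+1%:R^-1[).
  by rewrite setTI.
apply/seteqP; split=> X /=.
  move=> /signed_face_rat[N hN]; exists N => // m _; have [q qN qm] := hN m.
  by exists q.
move=> [N _ hN]; apply/signed_face_rat; exists N => m.
by have [q qN qm] := hN m I; exists q.
Qed.

End MatrixSigmaAlgebra.

Section RandomMatrix.
Variables (R : realType) (d : measure_display) (T : measurableType d)
  (P : probability T R) (n p : nat) (Z : 'I_n -> 'I_p -> {RV P >-> R}).

Local Notation mx := (measurable_matrix R n p).

Lemma measurable_random_mx : measurable_fun setT (random_mx Z : T -> mx).
Proof.
apply: (@measurability _ _ T mx setT (random_mx Z) (@matrix_boxes R n p)) => //.
move=> _ [_ [B mB ->] <-]; rewrite setTI.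
rewrite (_ : _ @^-1` _ = \bigcap_(li : 'I_n * 'I_p) (Z li.1 li.2 @^-1` B li.1 li.2)).
  apply: fin_bigcap_measurable => // li _.
  by rewrite -[_ @^-1` _]setTI; apply: measurable_funPT.
apply/seteqP; split=> w /=; first by move=> h [l i] _; have := h l i; rewrite mxE.
by move=> h l i; rewrite mxE; apply: (h (l, i)).
Qed.

Lemma measurable_signed_face_event (S : {set 'I_(p + p)}) :
  measurable [set w | signed_face (random_mx Z w) S].
Proof.
rewrite -[[set w | _]]setTI.
exact: (measurable_random_mx measurableT (measurable_signed_face S)).
Qed.

Variable mu : probability (measurableTypeR R) R.
Hypothesis Zmu : iid_entries Z mu.

Lemma probability_matrix_box (B : 'I_n -> 'I_p -> set R) :
  (forall l i, measurable (B l i)) ->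
  P [set w | matrix_box B (random_mx Z w)] = (\prod_l \prod_i mu (B l i))%E.
Proof.
move=> mB; case: Zmu => ind law.
have /= := ind [set: _]%SET (fun li => B li.1 li.2) (fun li => mB li.1 li.2).
rewrite pair_bigA /= (eq_bigl xpredT) => [|li]; last by rewrite inE.
under eq_bigr => li _ do rewrite -[P _]/(distribution P (Z li.1 li.2) _) law //.
move=> <-; congr (P _); apply/seteqP; split=> w /= h.
  by move=> [l i] _; have := h l i; rewrite mxE.
by move=> l i; rewrite mxE; apply: (h (l, i)); rewrite inE.
Qed.

Hypothesis mu_sym : symmetric_law mu.

(** The preimage of a box is a box with permuted and reflected sides, which has the same product
    probability by symmetry of [mu]; Dynkin's theorem extends this to all measurable sets. *)
Lemma random_mx_signed_perm (s : {perm 'I_p}) (e : 'I_p -> bool) (C : set mx) :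
  measurable C ->
  P [set w | C (signed_col_perm s e (random_mx Z w))] = P [set w | C (random_mx Z w)].
Proof.
pose flip (b : bool) (A : set R) := [set x | A ((-1) ^+ b * x)].
have mflip b A : measurable A -> measurable (flip b A).
  move=> mA; rewrite -[flip b A]setTI.
  have mf : measurable_fun setT (fun x : measurableTypeR R => (-1) ^+ b * x).
    by apply: measurable_funM; [exact: measurable_cst|exact: measurable_id].
  exact: mf.
have mu_flip b A : measurable A -> mu (flip b A) = mu A.
  move=> mA; case: b; last by congr (mu _); apply/seteqP; split=> x; rewrite /flip /= expr0 mul1r.
  rewrite -[RHS]mu_sym //; congr (mu _).
  by apply/seteqP; split=> x; rewrite /flip /= expr1 mulN1r.
have perm_box B X : matrix_box B (signed_col_perm s e X) <->
    matrix_box (fun l i => flip (e (s^-1 i)%g) (B l (s^-1 i)%g)) X.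
  split=> h l i; last by have := h l (s i); rewrite /flip /= permK mxE.
  by have := h l (s^-1 i)%g; rewrite mxE permKV.
have mperm : measurable_fun setT (signed_col_perm s e : mx -> mx).
  apply: (@measurability _ _ mx mx setT (signed_col_perm s e) (@matrix_boxes R n p)) => //.
  move=> _ [_ [B mB ->] <-]; rewrite setTI.
  apply: sub_sigma_algebra; exists (fun l i => flip (e (s^-1 i)%g) (B l (s^-1 i)%g)).
    by move=> l i; apply: mflip.
  by apply/seteqP; split=> X ? /=; apply/perm_box.
have mpermZ := measurableT_comp mperm measurable_random_mx.
have pre (f : T -> mx) A : measurable_fun setT f -> measurable A -> measurable (f @^-1` A).
  by move=> mf mA; rewrite -[_ @^-1` _]setTI; apply: mf.
pose eqP : set_system mx := fun A =>
  P [set w | A (signed_col_perm s e (random_mx Z w))] = P [set w | A (random_mx Z w)].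
apply: (@dynkin_induction _ mx (@matrix_boxes R n p) eqP erefl) => //.
- exact: matrix_boxesI.
- move=> _ [B mB ->]; rewrite /eqP.
  rewrite probability_matrix_box // (_ : [set w | _] =
    [set w | matrix_box (fun l i => flip (e (s^-1 i)%g) (B l (s^-1 i)%g)) (random_mx Z w)]).
    rewrite probability_matrix_box => [|l i]; last exact: mflip.
    apply: eq_bigr => l _; rewrite [RHS](reindex_inj (@perm_inj _ (s^-1)%g)) /=.
    by apply: eq_bigr => i _; apply: mu_flip.
  by apply/seteqP; split=> w ? /=; apply/perm_box.
- move=> A mA eqA; change (P (~` ((signed_col_perm s e \o random_mx Z : T -> mx) @^-1` A))
    = P (~` ((random_mx Z : T -> mx) @^-1` A))).
  rewrite !probability_setC; [|exact: pre measurable_random_mx mA|exact: pre mpermZ mA].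
  by congr (1 - _)%E; apply: eqA.
- move=> F mF tF eqF; change (
    P ((signed_col_perm s e \o random_mx Z : T -> mx) @^-1` \bigcup_k F k)
    = P ((random_mx Z : T -> mx) @^-1` \bigcup_k F k)).
  rewrite !preimage_bigcup !measure_bigcup //=;
    try (by move=> k _; exact: pre mpermZ (mF k));
    try (by move=> k _; exact: pre measurable_random_mx (mF k)).
  + by apply: eq_eseriesr => k _; apply: eqF.
  + by move=> i j _ _ [w [Fi Fj]]; apply: tF => //; exists (random_mx Z w).
  + move=> i j _ _ [w [Fi Fj]]; apply: tF => //.
    by exists (signed_col_perm s e (random_mx Z w)).
Qed.

Lemma probability_signed_face (k : nat) (S S' : {set 'I_(p + p)}) :
  S \in signed_models p k -> S' \in signed_models p k ->
  P [set w | signed_face (random_mx Z w) S'] = P [set w | signed_face (random_mx Z w) S].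
Proof.
move=> kS kS'; have [s [e <-]] := signed_perm_trans kS kS'.
rewrite -(random_mx_signed_perm s e (measurable_signed_face S)).
by congr (P _); apply/seteqP; split=> w ? /=; apply/signed_face_perm.
Qed.

(** The left side is the expected number of faces among the signed models of size [k], since all are
    equally likely to be faces; the right side bounds that number almost surely. *)
Lemma probability_signed_face_leq (lambda : R) (k m : nat) (S : {set 'I_(p + p)}) :
  0 < lambda -> {ae P, forall w, lasso_unique (random_mx Z w) lambda} ->
  m = n./2 -> (m <= k)%N -> S \in signed_models p k ->
  (('C(p, k) * 2 ^ k)%:R%:E * P [set w | signed_face (random_mx Z w) S] <=
    ('C(p, m) * 2 ^ m * 'C(n - m, k - m)).*2%:R%:E)%E.
Proof.
move=> l0 uni mn mk kS.
pose E S := [set w | signed_face (random_mx Z w) S].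
have mE S' : measurable (E S') := measurable_signed_face_event S'.
pose f (S' : {set 'I_(p + p)}) w : \bar R := (\1_(E S') w)%:E.
have mf S' : measurable_fun setT (f S') by apply/measurable_EFinP/measurable_indic.
have f0 S' w : (0 <= f S' w)%E by rewrite lee_fin.
have -> : (('C(p, k) * 2 ^ k)%:R%:E * P (E S) =
    \int[P]_w (\sum_(S' in signed_models p k) f S' w))%E.
  under eq_integral do rewrite -big_enum.
  rewrite ge0_integral_sum // big_enum /=.
  rewrite (eq_bigr (fun=> P (E S))) => [|S' kS']; last first.
    by rewrite integral_indic // setIT; apply: probability_signed_face kS kS'.
  by rewrite sumr_const card_signed_models mule_natl.
have -> : (('C(p, m) * 2 ^ m * 'C(n - m, k - m)).*2%:R%:E =
    \int[P]_w (cst (('C(p, m) * 2 ^ m * 'C(n - m, k - m)).*2%:R%:E) w) :> \bar R)%E.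
  rewrite integral_cst // [X in (_ * X)%E](_ : _ = 1%E) ?mule1 //.
  exact: probability_setT.
apply: ae_ge0_le_integral => //.
- by move=> w _; apply: sume_ge0 => S' _.
- under eq_fun do rewrite -big_enum; exact: emeasurable_sum.
- by move=> w _; rewrite lee_fin.
apply: filterS uni => w uni _.
rewrite /f sumEFin lee_fin /cst.
apply: (@le_trans _ _ #|[set S' : {set 'I_(p + p)} |
    `[< signed_face (random_mx Z w) S' >] & #|S'| == k]%SET|%:R); last first.
  by rewrite ler_nat; apply: card_signed_faces uni mn mk.
rewrite -sum1_card natr_sum big_mkcond [leRHS]big_mkcond; apply: ler_sum => S' _.
rewrite !inE indicE; case: (boolP (_ && _)) => [/andP[_ ->]|_]; last by case: ifP.
by rewrite andbT; case: asboolP => [?|nf]; [case: (_ \in _)|rewrite memNset].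
Qed.

End RandomMatrix.

(** * Asymptotics *)

Lemma leq_succ_expn (u : nat) : (u.+1 ^ u <= 3 * u ^ u)%N.
Proof.
case: u => [//|u']; set u := u'.+1.
(* [(1 + 1 / u) ^ k <= 1 + k / u + (k / u) ^ 2] *)
suff /(_ u (leqnn u)) h k : (k <= u)%N ->
    (u.+1 ^ k * u ^ 2 <= u ^ k * (u ^ 2 + k * u + k ^ 2))%N.
  by rewrite -(@leq_pmul2r (u ^ 2)) ?expn_gt0 // (leq_trans h) // -mulnn; nia.
elim: k => [_|k IH ku]; first by rewrite !expn0; nia.
rewrite [X in (X <= _)%N](_ : _ = u.+1 ^ k * u ^ 2 * u.+1)%N; last first.
  by rewrite [(u.+1 ^ _)%N]expnSr mulnAC.
apply: (@leq_trans (u ^ k * (u ^ 2 + k * u + k ^ 2) * u.+1)%N).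
  by rewrite leq_mul2r IH ?orbT // ltnW.
rewrite [(u ^ k.+1)%N]expnSr -!mulnA leq_mul2l; apply/orP; right; rewrite -!mulnn; nia.
Qed.

(** A crude form of Stirling's bound, with 3 in place of e. *)
Lemma expn_leq_fact (u : nat) : (u ^ u <= 3 ^ u * u`!)%N.
Proof.
elim: u => [//|u IH]; rewrite factS expnS.
rewrite (expnS 3) (mulnC 3) -mulnA [(3 * _)%N]mulnCA mulnCA leq_mul2l /=.
apply: leq_trans (leq_succ_expn u) _.
by rewrite mulnCA leq_mul2l.
Qed.

Lemma ffact_leq_expn (n u : nat) : (n ^_ u <= n ^ u)%N.
Proof. by elim: u => [//|u IH]; rewrite ffactnSr expnSr leq_mul ?leq_subr. Qed.

(** Factor by factor, [(n - i) / n <= (p - i) / p]. *)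
Lemma ffact_ratio (n p u : nat) : (n <= p)%N ->
  (n ^_ u * p ^ u <= p ^_ u * n ^ u)%N.
Proof.
move=> np; elim: u => [//|u IH]; rewrite !ffactnSr !expnSr !mulnA.
rewrite -(mulnAC (n ^_ u)) -(mulnAC (p ^_ u)) -!mulnA [(n ^_ u * _)%N]mulnA.
rewrite [(p ^_ u * _)%N]mulnA leq_mul // !mulnBl [(n * p)%N]mulnC leq_sub2l //.
by rewrite leq_mul2l np orbT.
Qed.

Lemma bin_ratio (n p u : nat) : (n <= p)%N ->
  ('C(n, u) * p ^ u <= 'C(p, u) * n ^ u)%N.
Proof.
move=> np; have := ffact_ratio u np; rewrite -!bin_ffact => h.
by rewrite -(@leq_pmul2r u`!) ?fact_gt0 // mulnAC (mulnAC 'C(p, u)).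
Qed.

Lemma bin_expn_leq (k u : nat) : ('C(k, u) * u ^ u <= (3 * k) ^ u)%N.
Proof.
have := ffact_leq_expn k u; rewrite -bin_ffact => h.
rewrite expnMn; apply: leq_trans (leq_mul (leqnn (3 ^ u)) h).
by rewrite mulnCA leq_mul2l expn_leq_fact orbT.
Qed.

(** Both sides count the pairs of nested subsets of sizes [m] and [k]. *)
Lemma mul_bin_trinomial (p k m : nat) : (m <= k <= p)%N ->
  ('C(p, k) * 'C(k, m) = 'C(p, m) * 'C(p - m, k - m))%N.
Proof.
case/andP=> mk kp.
apply/eqP; rewrite -(@eqn_pmul2r (m`! * (k - m)`! * (p - k)`!)) ?muln_gt0 ?fact_gt0 //.
rewrite -[X in X == _]mulnA [('C(k, m) * _)%N]mulnA bin_fact // bin_fact //.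
have := bin_fact (leq_sub2r m kp); have := bin_fact (leq_trans mk kp).
have -> : (p - m - (k - m) = p - k)%N by lia.
by move=> <- <-; apply/eqP; ring.
Qed.

Section Ratio.
Variable R : realType.

(** The trinomial identity cancels ['C(p, m) * 2 ^ m]. Then [bin_ratio] bounds
    ['C(n - m, u) / 'C(p - m, u)], and [bin_expn_leq] bounds ['C(k, m) = 'C(k, u)]. *)
Lemma ratio_bound (n p k m : nat) (x : R) : 0 <= x -> x <= 1 -> (m < k)%N ->
  (m <= n)%N -> (n <= p)%N ->
  ('C(p, k) * 2 ^ k)%:R * x <= ('C(p, m) * 2 ^ m * 'C(n - m, k - m)).*2%:R -> (k <= p)%N ->
  (2 * (k - m) * (p - m))%:R ^+ (k - m) * x <= 2 * (3 * k * (n - m))%:R ^+ (k - m).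
Proof.
move=> x0 x1 mk mn np h kp; set u := (k - m)%N in h *.
have kE : k = (u + m)%N by rewrite subnK // ltnW.
have Cpm : (0 < 'C(p, m))%N by rewrite bin_gt0 (leq_trans mn).
have Cpmu : (0 < 'C(p - m, u))%N by rewrite bin_gt0 leq_sub2r.
have h1 : ('C(p - m, u) * 2 ^ u)%:R * x <= ('C(k, m) * 'C(n - m, u)).*2%:R.
  rewrite -(@ler_pM2l _ ('C(p, m) * 2 ^ m)%:R) ?ltr0n ?muln_gt0 ?Cpm ?expn_gt0 //.
  rewrite mulrA -natrM -natrM.
  have -> : ('C(p, m) * 2 ^ m * ('C(p - m, u) * 2 ^ u) = 'C(p, k) * 2 ^ k * 'C(k, m))%N.
    by rewrite mulnACA -mul_bin_trinomial ?(ltnW mk) ?kp // -expnD addnC -kE; ring.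
  have -> : ('C(p, m) * 2 ^ m * ('C(k, m) * 'C(n - m, u)).*2 =
      ('C(p, m) * 2 ^ m * 'C(n - m, u)).*2 * 'C(k, m))%N by rewrite -!muln2; ring.
  by rewrite !natrM -mulrA [_%:R * x]mulrC mulrA -natrM ler_wpM2r ?ler0n.
have h2 : ('C(n - m, u) * (p - m) ^ u <= 'C(p - m, u) * (n - m) ^ u)%N.
  by apply: bin_ratio; rewrite leq_sub2r.
have h3 : ('C(k, m) * u ^ u <= (3 * k) ^ u)%N.
  by rewrite -bin_sub ?(ltnW mk) // bin_expn_leq.
rewrite -(@ler_pM2l _ 'C(p - m, u)%:R) ?ltr0n //.
have -> : 'C(p - m, u)%:R * ((2 * u * (p - m))%:R ^+ u * x) =
    (u ^ u * (p - m) ^ u)%:R * (('C(p - m, u) * 2 ^ u)%:R * x) :> R.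
  by rewrite -natrX !expnMn !natrM; ring.
apply: le_trans (_ : (u ^ u * (p - m) ^ u)%:R * ('C(k, m) * 'C(n - m, u)).*2%:R <= _).
  by rewrite ler_wpM2l ?ler0n.
rewrite -natrX -natrM [X in _ <= _ * X](_ : _ = (2 * (3 * k * (n - m)) ^ u)%:R :> R); last first.
  by rewrite natrM.
rewrite -natrM ler_nat [X in (_ <= X)%N](_ : _ =
  ((3 * k) ^ u * ('C(p - m, u) * (n - m) ^ u)).*2)%N; last by rewrite expnMn -muln2; ring.
rewrite [X in (X <= _)%N](_ : _ =
  ('C(k, m) * u ^ u * ('C(n - m, u) * (p - m) ^ u)).*2)%N; last by rewrite -!muln2; ring.
by rewrite leq_double leq_mul.
Qed.

End Ratio.

Section Eventually.
Variable R : realType.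

Lemma half_bounds (n : nat) : (n%:R / 2 - 1 <= n./2%:R :> R) && (n./2%:R <= n%:R / 2 :> R).
Proof.
have := odd_double_half n => /(congr1 (fun i => i%:R : R)).
rewrite natrD -muln2 natrM; case: (odd n) => /=; lra.
Qed.

(** The last hypothesis multiplied by [n ^+ 2]; its term [n^-1] absorbs the rounding in
    [n - m <= n / 2 + 1]. *)
Lemma ratio_compare (n k p m delta theta : R) : 0 < n -> n / 2 - 1 <= m -> m <= n / 2 ->
  0 < delta -> (2^-1 + delta) * n < k -> n < p -> 0 < theta ->
  3 * (k / n) * (2^-1 + n^-1) < theta * (2 * (k / n - 2^-1) * (p / n - 2^-1)) ->
  3 * k * (n - m) <= theta * (2 * (k - m) * (p - m)).
Proof.
move=> n0 m1 m2 d0 kn pn t0 h.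
have k0 : 0 < k by apply: lt_trans kn; rewrite mulr_gt0 //; lra.
have kn2 : n / 2 < k.
  by have := mulr_gt0 d0 n0; move: kn; rewrite mulrDl [_^-1 * n]mulrC; lra.
apply: (@le_trans _ _ (3 * (k / n) * (2^-1 + n^-1) * n ^+ 2)).
  have -> : 3 * (k / n) * (2^-1 + n^-1) * n ^+ 2 = 3 * k * (n / 2 + 1) by field; lra.
  by rewrite ler_wpM2l ?mulr_ge0 ?(ltW k0) //; lra.
apply: le_trans (ler_wpM2r (sqr_ge0 _) (ltW h)) _.
have -> : theta * (2 * (k / n - 2^-1) * (p / n - 2^-1)) * n ^+ 2 =
    theta * (2 * (k - n / 2) * (p - n / 2)) by field; lra.
rewrite ler_wpM2l ?(ltW t0) // ler_pM //; last by lra.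
- by rewrite mulr_ge0 //; lra.
- by lra.
- by rewrite ler_wpM2l //; lra.
Qed.

Lemma geometric_bound (n p k : nat) (x delta theta : R) (m := n./2) : 0 <= x <= 1 ->
  (0 < n)%N -> 0 < delta -> 2^-1 + delta < k%:R / n%:R -> 1 < p%:R / n%:R :> R ->
  0 < theta ->
  3 * (k%:R / n%:R) * (2^-1 + n%:R^-1) <
    theta * (2 * (k%:R / n%:R - 2^-1) * (p%:R / n%:R - 2^-1)) ->
  (k <= p)%N ->
  ('C(p, k) * 2 ^ k)%:R * x <= ('C(p, m) * 2 ^ m * 'C(n - m, k - m)).*2%:R ->
  x <= 2 * theta ^+ (k - m).
Proof.
case/andP=> x0 x1 n0 delta0 kn pn theta0 hk kp hx.
have nR : 0 < n%:R :> R by rewrite ltr0n.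
have /andP[m1 m2] := half_bounds n; rewrite -/m in m1 m2.
have kn' : (2^-1 + delta) * n%:R < k%:R by rewrite -ltr_pdivlMr.
have pn' : n%:R < p%:R :> R by rewrite -[n%:R]mul1r -ltr_pdivlMr.
have mk : (m < k)%N.
  rewrite -(ltr_nat R) (le_lt_trans m2) // (le_lt_trans _ kn') //.
  by rewrite mulrDl [_^-1 * _]mulrC lerDl mulr_ge0 ?ltW.
have mn : (m <= n)%N by rewrite /m leq_half_double -addnn leqW // leq_addr.
have np : (n < p)%N by rewrite -(ltr_nat R).
have := ratio_bound x0 x1 mk mn (ltnW np) hx kp.
set u := (k - m)%N; set B := (2 * u * (p - m))%:R; set A := (3 * k * (n - m))%:R => h.
have B0 : 0 < B by rewrite ltr0n !muln_gt0 !subn_gt0 mk (leq_ltn_trans mn np).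
have AB : A <= theta * B.
  rewrite /A /B !natrM !natrB ?(ltnW mk) ?(leq_trans mn (ltnW np)) //.
  exact: (@ratio_compare _ _ _ _ delta).
rewrite -(@ler_pM2l _ (B ^+ u)) ?exprn_gt0 // (le_trans h) //.
rewrite mulrCA ler_wpM2l // mulrC -exprMn lerXn2r ?nnegrE ?ler0n //.
by rewrite mulr_ge0 ?ltW.
Qed.

Lemma ratio_cvg0 (p k : nat -> nat) (x : nat -> R) (rho kappa : R) :
  ((p n)%:R / n%:R : R) @[n --> \oo] --> rho ->
  ((k n)%:R / n%:R : R) @[n --> \oo] --> kappa ->
  2^-1 < kappa -> kappa / (kappa - 2^-1) < rho ->
  (forall n, 0 <= x n <= 1) ->
  (forall n, x n = 0 \/ (k n <= p n)%N /\ ((n./2 <= k n)%N ->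
    ('C(p n, k n) * 2 ^ k n)%:R * x n <=
      ('C(p n, n./2) * 2 ^ n./2 * 'C(n - n./2, k n - n./2)).*2%:R)) ->
  x n @[n --> \oo] --> 0.
Proof.
move=> prho kkappa kappa_gt rho_gt x01 xle.
(* Half the gap, so that eventually [k n - n./2] exceeds [delta * n] and the exponent tends to
   infinity. *)
pose delta := (kappa - 2^-1) / 2.
have delta0 : 0 < delta by rewrite /delta; lra.
have near_n : \forall n \near \oo, (0 < n)%N by exists 1%N.
have near_k : \forall n \near \oo, 2^-1 + delta < (k n)%:R / n%:R :> R.
  by apply: (cvgr_gt kappa kkappa); rewrite /delta; lra.
(* If [1 < kappa], then eventually [n < k n] and the binomial on the right is 0. *)
have [kappa1|kappa1] := ltP 1 kappa.
  have near_k1 : \forall n \near \oo, 1 < (k n)%:R / n%:R :> R by exact: (cvgr_gt kappa kkappa).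
  apply/cvgrPdist_le => eps eps0; near=> n.
  have n0 : (0 < n)%N by near: n.
  have : 1 < (k n)%:R / n%:R :> R by near: n.
  rewrite ltr_pdivlMr ?ltr0n // mul1r ltr_nat => nk.
  have mk : (n./2 <= k n)%N by lia.
  have [->|[kp /(_ mk)]] := xle n.
    by rewrite subrr normr0 ltW.
  rewrite ['C(n - _, _)]bin_small; last by lia.
  rewrite muln0 double0 pmulr_rle0 ?ltr0n ?muln_gt0 ?bin_gt0 ?kp ?expn_gt0 // => xn.
  have [xn0 _] := andP (x01 n).
  by rewrite sub0r normrN ger0_norm // (le_trans xn) // ltW.
have rho1 : kappa < rho * (kappa - 2^-1) by rewrite -ltr_pdivrMr //; lra.
pose a := 3 * kappa * 2^-1; pose b := 2 * (kappa - 2^-1) * (rho - 2^-1).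
(* By [rho1], [b] exceeds [kappa + 2^-1], which is at least [a] because [kappa <= 1]. *)
have ab : a < b by rewrite /a /b; lra.
have a0 : 0 < a by rewrite /a; lra.
(* Chosen so that [theta * b] is the midpoint of [a] and [b]: it lies above [a], while
   [theta < 1]. *)
pose theta := (a + b) / (2 * b).
have b0 : 0 < b := lt_trans a0 ab.
have theta0 : 0 < theta by rewrite divr_gt0 //; lra.
have theta1 : theta < 1 by rewrite ltr_pdivrMr; lra.
have thetab : theta * b = (a + b) / 2 by rewrite /theta; field; lra.
have near_p : \forall n \near \oo, 1 < (p n)%:R / n%:R :> R.
  apply: (cvgr_gt rho prho); apply: lt_trans rho_gt.
  by rewrite ltr_pdivlMr; lra.
have near_ab : \forall n \near \oo, 3 * ((k n)%:R / n%:R) * (2^-1 + n%:R^-1) <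
    theta * (2 * ((k n)%:R / n%:R - 2^-1) * ((p n)%:R / n%:R - 2^-1)) :> R.
  have cva : 3 * ((k n)%:R / n%:R) * (2^-1 + n%:R^-1) @[n --> \oo] --> a.
    have cvn : n%:R^-1 @[n --> \oo] --> (0 : R) by rewrite -cvg_shiftS; exact: cvg_harmonic.
    have := cvgM (cvgM (@cvg_cst R 3 nat \oo _) kkappa) (cvgD (@cvg_cst R 2^-1 nat \oo _) cvn).
    rewrite addr0 => h; exact: h.
  have cvb : theta * (2 * ((k n)%:R / n%:R - 2^-1) * ((p n)%:R / n%:R - 2^-1))
     @[n --> \oo] --> theta * b.
    have cvk : ((k n)%:R / n%:R - 2^-1 : R) @[n --> \oo] --> kappa - 2^-1.
      by apply: cvgB => //; exact: cvg_cst.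
    have cvp : ((p n)%:R / n%:R - 2^-1 : R) @[n --> \oo] --> rho - 2^-1.
      by apply: cvgB => //; exact: cvg_cst.
    have h := cvgM (@cvg_cst R theta nat \oo _) (cvgM (cvgM (@cvg_cst R 2 nat \oo _) cvk) cvp).
    exact: h.
  have tab : 0 < theta * b - a by rewrite thetab; lra.
  apply: (filterS _ (cvgr_gt (theta * b - a) (cvgB cvb cva) 0 tab)).
  by move=> n h; rewrite -subr_gt0; exact: h.
apply/cvgrPdist_le => eps eps0.
have [N Neps] : exists N, 2 * theta ^+ N <= eps.
  have /cvgrPdist_le/(_ (eps / 2)) : theta ^+ n @[n --> \oo] --> 0.
    by apply: cvg_expr; rewrite gtr0_norm.
  case=> [|N _ /(_ N (leqnn N))]; first by rewrite divr_gt0.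
  by rewrite sub0r normrN gtr0_norm ?exprn_gt0 // => ?; exists N; lra.
(* From here on [delta * n] is at least [N], hence so is the exponent. *)
have near_N : \forall n \near \oo, N%:R / delta <= n%:R :> R by exact: nbhs_infty_ger.
near=> n; rewrite sub0r normrN.
have n0 : (0 < n)%N by near: n.
have kn : 2^-1 + delta < (k n)%:R / n%:R :> R by near: n.
have pn : 1 < (p n)%:R / n%:R :> R by near: n.
have abn : 3 * ((k n)%:R / n%:R) * (2^-1 + n%:R^-1) <
    theta * (2 * ((k n)%:R / n%:R - 2^-1) * ((p n)%:R / n%:R - 2^-1)) :> R by near: n.
have Nn : N%:R / delta <= n%:R :> R by near: n.
have /andP[xn0 xn1] := x01 n; rewrite ger0_norm //.
have [->|[kp xle_n]] := xle n; first exact: ltW.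
have nR : 0 < n%:R :> R by rewrite ltr0n.
have /andP[_ m2] := half_bounds n.
have kn' : n./2%:R + delta * n%:R < (k n)%:R.
  move: kn; rewrite ltr_pdivlMr // mulrDl [_^-1 * _]mulrC; apply: le_lt_trans.
  by rewrite lerD2r.
have mk : (n./2 <= k n)%N.
  by rewrite -(ler_nat R) ltW // (le_lt_trans _ kn') // lerDl mulr_ge0 ?ltW.
have uN : (N <= k n - n./2)%N.
  rewrite -(ler_nat R) natrB // lerBrDl ltW // (le_lt_trans _ kn') //.
  by rewrite lerD2l mulrC -ler_pdivrMr.
have := geometric_bound (x01 n) n0 delta0 kn pn theta0 abn kp (xle_n mk).
move=> /le_trans; apply; apply: le_trans Neps.
by rewrite ler_wpM2l // ler_wiXn2l ?ltW.
Unshelve. all: by end_near.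
Qed.

End Eventually.

Theorem theorem4p1 (R : realType) (p : nat -> nat) (lambda : nat -> R)
  (S : forall n : nat, {set 'I_(p n + p n)})
  (d : nat -> measure_display) (T : forall n : nat, measurableType (d n))
  (P : forall n : nat, probability (T n) R)
  (X0 : forall n : nat, 'I_n -> 'I_(p n) -> {RV (P n) >-> R})
  (mu : nat -> probability (measurableTypeR R) R)
  (rho kappa : R)
  (hlambda : forall n : nat, 0 < lambda n)
  (hrho : ((p n)%:R / n%:R : R) @[n --> \oo] --> rho)
  (hkappa : (#|S n|%:R / n%:R : R) @[n --> \oo] --> kappa)
  (hsym : forall n : nat, symmetric_law (mu n))
  (hiid : forall n : nat, iid_entries (X0 n) (mu n))
  (huniq : forall n : nat,
     {ae P n, forall w, lasso_unique (random_mx (X0 n) w) (lambda n)})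
  (hkappa_gt : 2^-1 < kappa)
  (hrho_gt : kappa / (kappa - 2^-1) < rho) :
  P n [set w | model_region (random_mx (X0 n) w) (lambda n) (S n) = set0]
    @[n --> \oo] --> 1%E.
Proof.
pose event n := [set w | signed_face (random_mx (X0 n) w) (S n)].
have mE n : measurable (event n) by apply: measurable_signed_face_event.
pose x n : R := fine (P n (event n)).
have xE n : P n (event n) = (x n)%:E by rewrite fineK // fin_num_measure.
have x01 n : 0 <= x n <= 1.
  by rewrite -!lee_fin -xE measure_ge0 probability_le1.
have -> : (fun n => P n [set w | model_region (random_mx (X0 n) w) (lambda n) (S n) = set0])
    = (fun n => (1 - x n)%:E).
  apply/funext => n; rewrite (_ : [set w | _] = ~` event n).
    by rewrite probability_setC // xE.
  by apply/seteqP; split=> w /=; rewrite (model_region_eq0 _ _ (hlambda n)).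
apply/cvg_EFin; first exact: nearW.
rewrite -[X in _ --> X]subr0; apply: cvgB; first exact: cvg_cst.
apply: (ratio_cvg0 hrho hkappa hkappa_gt hrho_gt x01) => n.
(* A model containing two opposite columns is never a face, so its probability is 0. *)
have [afS|nafS] := boolP (antipodal_free (S n)); last first.
  left; rewrite /x (_ : event n = set0) ?measure0 //.
  apply/seteqP; split=> // w /signed_face_antipodal_free.
  by rewrite (negbTE nafS).
have Smod : S n \in signed_models (p n) #|S n| by rewrite inE afS eqxx.
right; split=> [|mk].
  (* [S n] itself witnesses that ['C(p n, #|S n|)] is positive, which gives [#|S n| <= p n]. *)
  rewrite -bin_gt0; have : (0 < #|signed_models (p n) #|S n| |)%N.
    by apply/card_gt0P; exists (S n).
  by rewrite card_signed_models muln_gt0 => /andP[].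
have := probability_signed_face_leq (hiid n) (hsym n) (hlambda n) (huniq n)
  (erefl _) mk Smod.
by rewrite -/(event n) xE -EFinM lee_fin.
Qed.
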